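(* Let $N\ge1$, let $V:\mathbb{R}_+\to\mathbb{R}\cup\{\infty\}$ be such that the symmetric measure on $\mathbb{R}$ with density proportional to $e^{-V(x^2)}$ with respect to Lebesgue measure has finite moments of all orders, and assume that all distributions involved (the point process $\mathrm{E}_{\mathbb{R}}(N)$ and the root and power distributions defined from $V$) are characterized by their moments. Let $\{\lambda_1,\dots,\lambda_N\}$ be distributed according to $\mathrm{E}_{\mathbb{R}}(N)$. Then we have the equality in distribution of (unordered) random point sets, counted with multiplicity, $$\{\lambda_1^2,\dots,\lambda_N^2\}\stackrel{d}{=}\{x_1^2,\dots,x_N^2\},$$ where, for $k=1,2$, $(x_i)_{i\in I_k}$ is distributed according to $\mathrm{R}_{V,\mathbb{R}}(N,k)$, and the two families are independent. In other words, the distribution of the squares of $\mathrm{E}_{\mathbb{R}}(N)$ is a superposition of two independent Power distributions: $$\mathrm{E}_{\mathbb{R}}(N)^2\stackrel{d}{=}\mathrm{R}_{V,\mathbb{R}}(N,1)^2\cup\mathrm{R}_{V,\mathbb{R}}(N,2)^2\stackrel{d}{=}\mathrm{E}_{\mathbb{R}}(N,1)\cup\mathrm{E}_{\mathbb{R}}(N,2).$$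
   Context: For a point process $\mathrm{P}$, $\mathrm{P}^2$ denotes its image under squaring every point. For $k=1,2$, $I_k=\{i\in\{1,\dots,N\}: i\equiv k\pmod 2\}$. $\mathrm{E}_{\mathbb{R}}(N)$ is the random set of $N$ real points with joint density, with respect to Lebesgue measure on $\mathbb{R}^N$, proportional to $\prod_{i<j}|x_i-x_j|^2\prod_{i=1}^Ne^{-V(x_i^2)}$. The root distribution $\mathrm{R}_{V,\mathbb{R}}(N,k)$ is the point process on $\mathbb{R}$ indexed by $I_k$ with joint density proportional to $\prod_{i<j;\ i,j\in I_k}|x_i^2-x_j^2|^2\prod_{i\in I_k}x_i^{2(k-1)}e^{-V(x_i^2)}$. The Power distribution $\mathrm{E}_{\mathbb{R}}(N,k)$ is the image of $\mathrm{R}_{V,\mathbb{R}}(N,k)$ under squaring, i.e. the point process on $\mathbb{R}_+$ indexed by $I_k$ with joint density proportional to $\prod_{i<j;\ i,j\in I_k}|x_i-x_j|^2\prod_{i\in I_k}x_i^{k-3/2}e^{-V(x_i)}$. ''Characterized by their moments'' means that the law is uniquely determined, among probability laws, by the expectations of all polynomials in the points. *)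

(* Defs.v *)
From HB Require Import structures.
From mathcomp Require Import all_boot all_order all_algebra finmap multiset.
From mathcomp Require Import all_classical all_reals all_analysis.
From mathcomp Require mpoly.

Set Implicit Arguments.
Unset Strict Implicit.
Unset Printing Implicit Defensive.

Import Order.TTheory GRing.Theory Num.Theory.
Import numFieldNormedType.Exports.

Local Open Scope classical_set_scope.
Local Open Scope ring_scope.

(* Lebesgue measure on R^n, with R^n rendered as n.-tuple R under the library's
   product (Borel) sigma-algebra: the library has binary products only. *)
Section lebesgue_tuple.
Context (R : realType).

Definition cons_pair n (p : measurableTypeR R * n.-tuple (measurableTypeR R)) :
  n.+1.-tuple (measurableTypeR R) := [tuple of p.1 :: p.2].

Lemma measurable_cons_pair n : measurable_fun setT (@cons_pair n).
Proof. exact: measurable_cons. Qed.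

Section lebesgue_cons.
Variables (n : nat)
  (mu : {sigma_finite_measure set (n.-tuple (measurableTypeR R)) -> \bar R}).

Definition lebesgue_cons : set (n.+1.-tuple (measurableTypeR R)) -> \bar R :=
  pushforward (lebesgue_measure \x mu)%E (@cons_pair n).

Let lebesgue_cons0 : lebesgue_cons set0 = 0%E.
Proof. by rewrite /lebesgue_cons /pushforward preimage_set0 measure0. Qed.

Let lebesgue_cons_ge0 A : (0 <= lebesgue_cons A)%E.
Proof. exact: (measure_ge0 (lebesgue_measure \x mu)%E). Qed.

Let lebesgue_cons_sigma_additive : semi_sigma_additive lebesgue_cons.
Proof.
move=> F mF tF mUF; rewrite /lebesgue_cons /pushforward preimage_bigcup.
have mc B : measurable B -> measurable (@cons_pair n @^-1` B).
  by move=> mB; rewrite -[X in measurable X]setTI; exact: measurable_cons_pair.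
apply: measure_semi_sigma_additive.
- by move=> i; exact: mc.
- apply/trivIsetP => /= i j _ _ ij; rewrite -preimage_setI.
  by move/trivIsetP : tF => /(_ _ _ _ _ ij) ->//; rewrite preimage_set0.
- by rewrite -preimage_bigcup; exact: mc.
Qed.

HB.instance Definition _ := isMeasure.Build _ _ _ lebesgue_cons
  lebesgue_cons0 lebesgue_cons_ge0 lebesgue_cons_sigma_additive.

Let lebesgue_cons_sigma_finite : sigma_finite setT lebesgue_cons.
Proof.
have /sigma_finiteP[F [FT Fnd Foo]] := sigma_finiteT (@lebesgue_measure R).
have /sigma_finiteP[G [GT Gnd Goo]] := sigma_finiteT mu.
pose u (t : n.+1.-tuple (measurableTypeR R)) :
  measurableTypeR R * n.-tuple (measurableTypeR R) :=
  (thead t, [tuple of behead t]).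
have mu_ : measurable_fun setT u.
  by apply/measurable_fun_pair; [exact: measurable_tnth|exact: measurable_behead].
have uK : cancel (@cons_pair n) u.
  by move=> [x t]; rewrite /u; congr pair; apply/val_inj.
exists (fun i => u @^-1` (F i `*` G i)).
  apply/esym/seteqP; split => // t _.
  have : (\bigcup_i F i) (u t).1 by rewrite -FT.
  have : (\bigcup_i G i) (u t).2 by rewrite -GT.
  move=> [j _ Gj] [i _ Fi]; exists (maxn i j) => //; split.
  - by move: Fi; exact/subsetPset/Fnd/leq_maxl.
  - by move: Gj; exact/subsetPset/Gnd/leq_maxr.
move=> i; have [mF Fi] := Foo i; have [mG Gi] := Goo i; split.
  by rewrite -[X in measurable X]setTI; apply: mu_ => //; exact: measurableX.
rewrite /lebesgue_cons /pushforward -comp_preimage.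
rewrite (_ : u \o _ = id) ?preimage_id; last by apply/funext => p /=; rewrite uK.
by rewrite product_measure1E// lte_mul_pinfty// ge0_fin_numE.
Qed.

HB.instance Definition _ := Measure_isSigmaFinite.Build _ _ _ lebesgue_cons
  lebesgue_cons_sigma_finite.

End lebesgue_cons.

Fixpoint lebesgue_tuple n :
    {sigma_finite_measure set (n.-tuple (measurableTypeR R)) -> \bar R} :=
  if n is m.+1 then lebesgue_cons (lebesgue_tuple m) else \d_[tuple].

End lebesgue_tuple.

Section point_processes.
Context (R : realType).

(* A process of n real points is given by a labelling X : T -> R^n of its points;
   [seq_mset (X w)] is the unordered set of points with multiplicities.  The
   sigma-algebra on configurations is the quotient one: A is an event when its
   preimage in R^n is Borel. *)
Definition eqd_points d1 (T1 : measurableType d1) (P1 : probability T1 R)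
    d2 (T2 : measurableType d2) (P2 : probability T2 R) n
    (X1 : T1 -> n.-tuple R) (X2 : T2 -> n.-tuple R) : Prop :=
  forall A : set (multiset R),
    measurable [set t : n.-tuple (measurableTypeR R) | A (seq_mset t)] ->
    P1 [set w | A (seq_mset (X1 w))] = P2 [set w | A (seq_mset (X2 w))].

(* The law of X is absolutely continuous on R^n with density proportional
   to f; the constant c is pinned down by the total mass 1. *)
Definition has_density_propto d (T : measurableType d) (P : probability T R) n
    (X : T -> n.-tuple R) (f : n.-tuple R -> R) : Prop :=
  exists c : R, forall A : set (n.-tuple (measurableTypeR R)), measurable A ->
    P (X @^-1` A) = (c%:E * \int[lebesgue_tuple R n]_(t in A) (f t)%:E)%E.

Definition independent d (T : measurableType d) (P : probability T R) m n
    (X : T -> m.-tuple R) (Y : T -> n.-tuple R) : Prop :=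
  forall (A : set (m.-tuple (measurableTypeR R)))
         (B : set (n.-tuple (measurableTypeR R))),
    measurable A -> measurable B ->
    P (X @^-1` A `&` Y @^-1` B) = (P (X @^-1` A) * P (Y @^-1` B))%E.

(* Among laws of n points of S, the law of the point process X is determined by
   the expectations of all polynomials in the points. *)
Definition moment_determinate d (T : measurableType d) (P : probability T R) n
    (S : set R) (X : T -> n.-tuple R) : Prop :=
  forall Q : probability (n.-tuple (measurableTypeR R)) R,
    Q [set t | forall i, S (tnth t i)] = 1%E ->
    (forall p : mpoly.mpoly n R,
      Q.-integrable setT (fun t => (mpoly.meval (tnth t) p)%:E) /\
      (\int[Q]_t (mpoly.meval (tnth t) p)%:E =
       \int[P]_w (mpoly.meval (tnth (X w)) p)%:E)%E) ->
    eqd_points Q P id X.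

Definition sqr_points n (t : n.-tuple R) : n.-tuple R :=
  [tuple of [seq x ^+ 2 | x <- t]].

(* 'I_N stands for {1, ..., N} through i |-> i.+1. *)
Definition parity_class (N k : nat) : {set 'I_N} :=
  [set i : 'I_N | i.+1 == k %[mod 2]]%SET.

(* The subfamily (t_i) for i in I_k, listed in increasing order of i. *)
Definition parity_part N k (t : N.-tuple R) : #|parity_class N k|.-tuple R :=
  [tuple tnth t (enum_val j) | j < #|parity_class N k|].

(* The potential V : R_+ -> R u {oo} enters through its weight e^(-V), which is 0
   where V = +oo; only values of V on R_+ are used. *)
Definition weight (V : R -> \bar R) (x : R) : R := fine (expeR (- V x)%E).

Definition sqr_vandermonde n (t : n.-tuple R) : R :=
  \prod_(i < n) \prod_(j < n | (i < j)%N) `|tnth t i - tnth t j| ^+ 2.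

Definition ensemble_density V N (t : N.-tuple R) : R :=
  sqr_vandermonde t * \prod_(i < N) weight V (tnth t i ^+ 2).

Definition root_density V N k (t : #|parity_class N k|.-tuple R) : R :=
  sqr_vandermonde (sqr_points t) *
  \prod_(i < #|parity_class N k|)
    (tnth t i ^+ (2 * (k - 1)) * weight V (tnth t i ^+ 2)).

(* Density of the squares of points with density root_density: the substitution
   y = x^2 on the half-line turns x^(2(k-1)) dx into a multiple of y^(k-3/2) dy. *)
Definition power_density V N k (t : #|parity_class N k|.-tuple R) : R :=
  if [forall i, 0 <= tnth t i] then
    sqr_vandermonde t *
    \prod_(i < #|parity_class N k|)
      (tnth t i `^ (k%:R - 3 / 2) * weight V (tnth t i))
  else 0.

End point_processes.

(* Main.v *)
Require Import Defs.
From HB Require Import structures.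
From mathcomp Require Import all_boot all_order all_algebra all_fingroup.
From mathcomp Require Import all_classical all_reals all_analysis.
From mathcomp Require Import measurable_realfun lebesgue_integral_fubini.
From mathcomp Require Import simple_functions measurable_fun_approximation.
From mathcomp Require Import finmap multiset ring lra zify.
Import Order.TTheory GRing.Theory Num.Theory.
Import numFieldNormedType.Exports.
Set Implicit Arguments.
Unset Strict Implicit.
Unset Printing Implicit Defensive.
Local Open Scope ring_scope.

(* The density of E_R(N) is the square of the Vandermonde determinant det(x_i^j)
   times a weight that is even in each point.  Average it over all sign changes of
   the points: in the double sum over permutations s, u coming from the square of
   the determinant, only the terms where s(i) and u(i) have the same parity for
   every i survive, and these are, up to a constant, the sum over all relabellings
   r of the square of the determinant obtained by keeping only the entries x_r(i)^j
   with i and j in the same parity class.  The latter determinant is block diagonal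
   and its square is the product of the two root densities.  Events on unordered
   squares do not see signs and labels, and Lebesgue measure is invariant under
   both, so the two laws are proportional, hence equal.  Power densities follow
   from the substitution y = x^2 in each coordinate. *)

(** * Squared Vandermonde determinants averaged over signs *)

Section interlaced_vandermonde.
Variables (m n : nat).
Hypothesis le_nm : (n <= m)%N.
Hypothesis le_mn : (m <= n.+1)%N.
Variable F : comPzRingType.

(* The exponents 0, ..., m + n - 1 with the m even ones listed before the n odd ones. *)
Definition interlace (j : 'I_(m + n)) : nat :=
  match fintype.split j with inl a => a.*2 | inr b => b.*2.+1 end.

Lemma interlace_lshift (a : 'I_m) : interlace (lshift n a) = a.*2.
Proof. by rewrite /interlace; case: (split_ordP (lshift n a)) => j /eqP;
  rewrite ?eq_lshift ?eq_lrshift// => /eqP ->. Qed.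

Lemma interlace_rshift (b : 'I_n) : interlace (rshift m b) = b.*2.+1.
Proof. by rewrite /interlace; case: (split_ordP (rshift m b)) => j /eqP;
  rewrite ?eq_rshift ?eq_rlshift// => /eqP ->. Qed.

Lemma odd_interlace j : odd (interlace j) = (m <= j)%N.
Proof.
case: (split_ordP j) => a ->; rewrite ?interlace_lshift ?interlace_rshift /= odd_double.
  by rewrite leqNgt ltn_ord.
by rewrite leq_addr.
Qed.

(** The top even exponent [2(m - 1)] stays below [m + n] because [m <= n + 1], and the top odd
    exponent [2n - 1] because [n <= m]. *)
Lemma interlace_lt j : (interlace j < m + n)%N.
Proof.
case: (split_ordP j) => a ->; rewrite ?interlace_lshift ?interlace_rshift;
  have := ltn_ord a; lia.
Qed.

Lemma interlace_inj : injective interlace.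
Proof.
move=> i j; case: (split_ordP i) => a ->; case: (split_ordP j) => b ->;
  rewrite ?interlace_lshift ?interlace_rshift => /eqP.
- by rewrite -!muln2 eqn_mul2r /= => /eqP/val_inj ->.
- by move/eqP/(congr1 odd); rewrite /= !odd_double.
- by move/eqP/(congr1 odd); rewrite /= !odd_double.
- by rewrite eqSS -!muln2 eqn_mul2r /= => /eqP/val_inj ->.
Qed.

Definition interlace_det (t : 'I_(m + n) -> F) : F :=
  \det (\matrix_(i, j) t i ^+ interlace j).

Definition split_det (t : 'I_(m + n) -> F) : F :=
  \det (\matrix_(i, j) (if (m <= i)%N == (m <= j)%N then t i ^+ interlace j else 0)).

(** This is the subgroup [S_m x S_n]; the relabellings compatible with a given permutation will form
    one of its cosets. *)
Definition block_perms : {set {perm 'I_(m + n)}} :=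
  [set s : {perm 'I_(m + n)} | [forall i, (m <= s i)%N == (m <= i)%N]]%SET.

(** In the Leibniz expansion, a permutation that sends some index to the other block picks up a zero
    entry. *)
Lemma split_detE t : split_det t =
  \sum_(s in block_perms) (-1) ^+ s * \prod_i t i ^+ interlace (s i).
Proof.
rewrite [LHS]/determinant [RHS]big_mkcond; apply: eq_bigr => s _.
rewrite inE; case: ifPn => [/forallP sG|].
  by congr (_ * _); apply: eq_bigr => i _; rewrite mxE eq_sym sG.
rewrite negb_forall => /existsP[i si].
by rewrite (bigD1 i)//= mxE eq_sym (negbTE si) mul0r mulr0.
Qed.

(** The sum over sign vectors factors over the coordinates, with factors [1 + (-1)^(k i)], each
    equal to 2 or 0. *)
Lemma sum_signs (k : 'I_(m + n) -> nat) :
  \sum_(e : {ffun 'I_(m + n) -> bool}) \prod_i ((-1) ^+ e i) ^+ k i =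
  (if [forall i, ~~ odd (k i)] then 2 ^+ (m + n) else 0) :> F.
Proof.
rewrite -(bigA_distr_bigA (fun i (b : bool) => ((-1) ^+ b) ^+ k i : F)).
rewrite [LHS](eq_bigr (fun i => if odd (k i) then 0 else 2)); last first.
  move=> i _; rewrite big_bool /= expr1 expr0 expr1n -signr_odd.
  by case: (odd _); rewrite ?expr1 ?expr0 ?addNr.
case: ifPn => [/forallP ev|].
  under eq_bigr => i _ do rewrite (negbTE (ev i)).
  by rewrite prodr_const card_ord.
rewrite negb_forall => /existsP[i]; rewrite negbK => oi.
by rewrite (bigD1 i)//= oi mul0r.
Qed.

(* Grouping the pairs (s, u) of permutations with matching parities as (r^-1 p, r^-1 q)
   with p, q in block_perms hits each pair exactly #|block_perms| times. *)
Lemma sum_interlace_det (t : 'I_(m + n) -> F) :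
  #|block_perms|%:R *
    (\sum_(e : {ffun 'I_(m + n) -> bool}) interlace_det (fun i =>
      (-1) ^+ e i * t i) ^+ 2) =
  2 ^+ (m + n) * \sum_(r : {perm 'I_(m + n)}) split_det (t \o r) ^+ 2.
Proof.
pose S (s u : {perm 'I_(m + n)}) : F :=
  (-1) ^+ s * (-1) ^+ u * \prod_i t i ^+ (interlace (s i) + interlace (u i)).
pose agree (s u : {perm 'I_(m + n)}) := [forall i, (m <= s i)%N == (m <= u i)%N].
have L : \sum_(e : {ffun 'I_(m + n) -> bool}) interlace_det (fun i =>
  (-1) ^+ e i * t i) ^+ 2
    = 2 ^+ (m + n) * \sum_s \sum_(u | agree s u) S s u.
  transitivity (\sum_s \sum_u \sum_(e : {ffun 'I_(m + n) -> bool}) S s u *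
     \prod_i ((-1) ^+ e i) ^+ (interlace (s i) + interlace (u i))).
    under [RHS]eq_bigr do rewrite exchange_big.
    rewrite exchange_big; apply: eq_bigr => e _.
    rewrite expr2 /interlace_det {1}/determinant mulr_suml; apply: eq_bigr => s _.
    rewrite /determinant mulr_sumr; apply: eq_bigr => u _.
    rewrite /S mulrACA -[RHS]mulrA -!big_split /=; congr (_ * _); apply: eq_bigr => i _.
    by rewrite !mxE -exprD exprMn mulrC.
  rewrite mulr_sumr; apply: eq_bigr => s _.
  rewrite mulr_sumr [RHS]big_mkcond; apply: eq_bigr => u _.
  rewrite -mulr_sumr sum_signs.
  have -> : [forall i, ~~ odd (interlace (s i) + interlace (u i))] = agree s u.
    by apply: eq_forallb => i; rewrite oddD !odd_interlace; case: (_ <= s i)%N;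
      case: (_ <= u i)%N.
  by case: ifP => _; rewrite ?mulr0// mulrC.
(* Replacing [s] by [r * s] moves the relabelling of the points into the range of summation; the
   sign of [r] occurs twice and cancels. *)
have Rr (r : {perm 'I_(m + n)}) : split_det (t \o r) ^+ 2 =
    \sum_(s | (r * s)%g \in block_perms) \sum_(u | (r * u)%g \in block_perms) S s u.
  rewrite expr2 split_detE.
  have E : \sum_(s in block_perms) (-1) ^+ s * \prod_i (t \o r) i ^+ interlace (s i) =
     \sum_(s | (r * s)%g \in block_perms) (-1) ^+ r *
       ((-1) ^+ s * \prod_i t i ^+ interlace (s i)).
    rewrite (reindex_inj (mulgI r)); apply: eq_bigr => s _.
    rewrite odd_permM signr_addb -mulrA; congr (_ * (_ * _)).
    rewrite [RHS](reindex_inj (@perm_inj _ r)); apply: eq_bigr => i _.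
    by rewrite permM.
  rewrite E -!mulr_sumr mulrACA -signr_addb addbb mul1r mulr_suml.
  apply: eq_bigr => s _; rewrite mulr_sumr; apply: eq_bigr => u _.
  rewrite /S mulrACA -big_split; congr (_ * _); apply: eq_bigr => i _.
  by rewrite exprD.
have {}Rr (r : {perm 'I_(m + n)}) : split_det (t \o r) ^+ 2 = \sum_s \sum_u
    (if ((r * s)%g \in block_perms) && ((r * u)%g \in block_perms) then S s u else 0).
  rewrite Rr big_mkcond; apply: eq_bigr => s _.
  case: ifP => _; first by rewrite big_mkcond.
  by rewrite big1.
rewrite L mulrCA; congr (_ * _).
under [RHS]eq_bigr do rewrite Rr.
rewrite mulr_sumr [RHS]exchange_big.
apply: eq_bigr => s _; rewrite mulr_sumr [LHS]big_mkcond [RHS]exchange_big.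
apply: eq_bigr => u _; rewrite -big_mkcond.
rewrite sumr_const -[RHS]mulr_natl; case: ifPn => [su|nsu].
  congr (_%:R * _); rewrite -(card_rcoset block_perms s^-1%g).
  apply: eq_card => r; rewrite mem_rcoset invgK [RHS]inE.
  have -> : (r * u \in block_perms)%g = (r * s \in block_perms)%g.
    rewrite !inE; apply: eq_forallb => i; rewrite !permM.
    by rewrite (eqP (forallP su (r i))).
  by rewrite andbb.
(* Without matching parities no [r] qualifies: membership of [r * s] and [r * u], read at [r^-1 i],
   puts [s i] and [u i] in the same block. *)
rewrite (_ : #|_| = 0%N) ?mul0r //; apply: eq_card0 => r; apply/negP.
rewrite inE => /andP[]; rewrite !inE => /forallP rs /forallP ru.
case/negP: nsu; apply/forallP => i.
have := rs (r^-1 i)%g; have := ru (r^-1 i)%g; rewrite !permM permKV.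
by move=> /eqP -> /eqP ->.
Qed.
End interlaced_vandermonde.

(** The Vandermonde formula has the differences in the opposite order and without absolute values;
    squaring removes both discrepancies. *)
Lemma det_powers_sqr (R : realType) n (t : n.-tuple R) :
  (\det (\matrix_(i < n, j < n) tnth t i ^+ j)) ^+ 2 = sqr_vandermonde t.
Proof.
rewrite -det_tr (_ : _^T = Vandermonde n (\row_j tnth t j)); last first.
  by apply/matrixP => i j; rewrite !mxE.
rewrite det_Vandermonde /sqr_vandermonde -prodrXl; apply: eq_bigr => i _.
rewrite -prodrXl; apply: eq_bigr => j _.
by rewrite !mxE real_normK ?num_real// -sqrrN opprB.
Qed.

Section interlaced_vandermonde_sqr.
Variables (R : realType) (m n : nat).
Hypothesis le_nm : (n <= m)%N.
Hypothesis le_mn : (m <= n.+1)%N.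

(** Interlacing only permutes the columns of the Vandermonde matrix, so the determinant changes at
    most by a sign. *)
Lemma interlace_det_sqr (t : (m + n).-tuple R) :
  interlace_det (tnth t) ^+ 2 = sqr_vandermonde t.
Proof.
pose r (j : 'I_(m + n)) : 'I_(m + n) := Ordinal (interlace_lt le_nm le_mn j).
have rI : injective r by move=> i j /(congr1 val); exact: interlace_inj.
rewrite -det_powers_sqr /interlace_det.
have -> : \matrix_(i, j) tnth t i ^+ interlace j =
    col_perm (perm rI) (\matrix_(i, j) tnth t i ^+ j).
  by apply/matrixP => i j; rewrite !mxE permE.
by rewrite col_permE det_mulmx det_perm exprMn sqrr_sign mulr1.
Qed.

(** Both diagonal blocks are Vandermonde matrices in the squared points, once [v_i] is pulled out of
    each row of the odd block. These factors are the origin of [x^(2(k-1))] in the root density for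
    [k = 2]. *)
Lemma split_det_sqr (u : m.-tuple R) (v : n.-tuple R) :
  split_det (tnth [tuple of u ++ v]) ^+ 2 =
  sqr_vandermonde (sqr_points u) *
  (sqr_vandermonde (sqr_points v) * \prod_(i < n) tnth v i ^+ 2).
Proof.
rewrite /split_det (_ : \matrix_(i, j) _ =
    block_mx (\matrix_(i < m, j < m) tnth (sqr_points u) i ^+ j) 0 0
      (diag_mx (\row_j tnth v j) *m \matrix_(i < n, j < n) tnth (sqr_points v) i ^+ j)).
  rewrite det_ublock det_mulmx det_diag exprMn det_powers_sqr; congr (_ * _).
  rewrite exprMn mulrC det_powers_sqr; congr (_ * _).
  by rewrite -prodrXl; apply: eq_bigr => i _; rewrite mxE.
have ltF (a : 'I_m) : (m <= a)%N = false by rewrite leqNgt ltn_ord.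
apply/matrixP => i j; rewrite mxE.
case: (split_ordP i) => a ->; case: (split_ordP j) => b ->;
  rewrite ?(interlace_lshift, interlace_rshift, tnth_lshift, tnth_rshift,
    block_mxEul, block_mxEur, block_mxEdl, block_mxEdr) /= ?leq_addr ?ltF /= ?mxE //.
- by rewrite tnth_map -exprM mul2n.
- rewrite (bigD1 a) //= big1 ?addr0; last first.
    by move=> k ka; rewrite !mxE eq_sym (negbTE ka) mulr0n mul0r.
  by rewrite !mxE eqxx mulr1n tnth_map -exprM mul2n exprS.
Qed.

End interlaced_vandermonde_sqr.

Local Open Scope classical_set_scope.
Local Notation borel R := (measurableTypeR R).

(** * Lebesgue measure on tuples *)

Section tuple_measure.
Context {R : realType}.
Implicit Types n : nat.

Lemma ge0_integral_lebesgue_cons n (f : n.+1.-tuple (borel R) -> \bar R) :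
  measurable_fun setT f -> (forall t, 0 <= f t)%E ->
  (\int[lebesgue_tuple R n.+1]_t f t =
   \int[@lebesgue_measure R]_x \int[lebesgue_tuple R n]_t f (cons_pair (x, t)))%E.
Proof.
move=> mf f0.
rewrite (@ge0_integral_pushforward _ _ _ _ _ _ (@measurable_cons_pair R n)
  (lebesgue_measure \x lebesgue_tuple R n)%E setT f)//.
rewrite preimage_setT.
rewrite (fubini_tonelli1 (f \o @cons_pair R n))//.
  by apply: measurableT_comp => //; exact: measurable_cons_pair.
by move=> x; exact: f0.
Qed.

Definition box n (B : 'I_n -> set (borel R)) : set (n.-tuple (borel R)) :=
  [set t | forall i, B i (tnth t i)].

Lemma boxE n (B : 'I_n -> set (borel R)) :
  box B = \big[setI/setT]_(i < n) ((@tnth n (borel R))^~ i @^-1` B i).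
Proof. by rewrite -bigcap_seq; apply/seteqP; split => t /= H i; [move=> _ | ];
  apply: H; rewrite /= mem_index_enum. Qed.

Lemma measurable_box n (B : 'I_n -> set (borel R)) :
  (forall i, measurable (B i)) -> measurable (box B).
Proof.
move=> mB; rewrite boxE; apply: bigsetI_measurable => i _.
by rewrite -[X in measurable X]setTI; exact: measurable_tnth.
Qed.

Lemma lebesgue_box n (B : 'I_n -> set (borel R)) :
  (forall i, measurable (B i)) ->
  (lebesgue_tuple R n (box B) = \prod_(i < n) lebesgue_measure (B i))%E.
Proof.
elim: n B => [|n IH] B mB.
  by rewrite big_ord0 /= diracE mem_set// => -[].
have -> : lebesgue_tuple R n.+1 (box B) =
  (lebesgue_measure \x lebesgue_tuple R n)%E (B ord0 `*` box (fun i => B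
    (lift ord0 i))).
  rewrite /= /lebesgue_cons /pushforward; congr (_ _); apply/seteqP; split=> -[x t] /=.
    by move=> H; split; [exact: (H ord0)|move=> i; have := H (lift ord0 i);
      rewrite tnthS].
  by move=> [H1 H2] i; case: (unliftP ord0 i) => [j ->|->]; rewrite ?tnthS ?tnth0//=;
    apply: H2.
rewrite product_measure1E//; last exact: measurable_box.
by rewrite IH// big_ord_recl.
Qed.

(** Boxes are stable under intersection and generate the product sigma-algebra, and the cubes
    [[-k, k]^n] have finite measure and exhaust the space. *)
Lemma tuple_measure_unique n
    (m : {measure set (n.-tuple (borel R)) -> \bar R}) :
  (forall B : 'I_n -> set (borel R), (forall i, measurable (B i)) ->
    m (box B) = \prod_(i < n) lebesgue_measure (B i))%E ->
  forall A, measurable A -> m A = lebesgue_tuple R n A.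
Proof.
move=> mE A mA.
pose G := [set A : set (n.-tuple (borel R)) |
  exists2 B : 'I_n -> set (borel R), (forall i, measurable (B i)) & A = box B].
apply: (measure_unique G (fun k => box (fun=> `[- k%:R, k%:R]%classic))) => // {A mA}.
- rewrite eqEsubset; split.
    apply: smallest_sub; first exact: smallest_sigma_algebra.
    move=> A; rewrite -bigcup_seq => -[i _ [B mB <-]].
    apply: sub_sigma_algebra; exists (fun j => if j == i then B else setT).
      by move=> j; case: ifP.
    apply/seteqP; split => [t [_ Bt] j|t /(_ i)]; last by rewrite eqxx.
    by case: eqP => // ->.
  apply: smallest_sub; first exact: sigma_algebra_measurable.
  by move=> _ [B mB ->]; exact: measurable_box.
- move=> _ _ [B mB ->] [C mC ->]; exists (fun i => B i `&` C i).
    by move=> i; exact: measurableI.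
  by apply/seteqP; split => [t [Bt Ct] i|t BCt]; split => // i; have [] := BCt i.
- by move=> k; exists (fun=> `[- k%:R, k%:R]%classic).
- apply/seteqP; split => // t _.
  have [k kP] : exists k : nat, forall i, `|tnth t i| <= k%:R.
    exists (Num.truncn (\sum_i `|tnth t i|)).+1 => i.
    apply: le_trans (ltW (truncnS_gt _)).
    by rewrite (bigD1 i)//= lerDl sumr_ge0.
  by exists k => // i; rewrite /= in_itv/= -ler_norml.
- by move=> _ [B mB ->]; rewrite mE//; exact/esym/lebesgue_box.
- move=> k; rewrite mE//.
  under eq_bigr do rewrite lebesgue_measure_itv/=.
  (* The interval is degenerate at [k = 0]: the product is then 0, or the empty product when
     [n = 0]. *)
  case: ifP => _; last first.
    by case: n {m mE G} => [|n]; rewrite ?big_ord0 ?ltry// big_ord_recl mul0e.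
  by under eq_bigr do rewrite -EFinD; rewrite prodEFin ltry.
Qed.

End tuple_measure.

(** * Signed permutations and concatenation of tuples under the integral *)

Section tuple_integral.
Context {R : realType}.
Implicit Types n : nat.

Definition signed_perm n (s : {perm 'I_n}) (e : 'I_n -> bool)
    (t : n.-tuple (borel R)) : n.-tuple (borel R) :=
  [tuple (-1) ^+ e i * tnth t (s i) : R | i < n].

Lemma measurable_signed_perm n (s : {perm 'I_n}) (e : 'I_n -> bool) :
  measurable_fun setT (signed_perm s e).
Proof.
apply/measurable_fun_tnthP => i.
rewrite (_ : _ \o _ = fun t => (-1) ^+ e i * (tnth t (s i) : R)); last first.
  by apply/funext => t /=; rewrite tnth_mktuple.
apply: measurable_funM => //; exact: measurable_tnth.
Qed.

Lemma lebesgue_measure_sign (b : bool) (B : set (borel R)) : measurable B ->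
  lebesgue_measure ((fun x : R => (-1) ^+ b * x) @^-1` B) = lebesgue_measure B.
Proof.
move=> mB; case: b => /=.
  by rewrite -[RHS]lebesgue_measureN//; congr lebesgue_measure; apply/seteqP;
    split => x /=; rewrite mulN1r.
by congr lebesgue_measure; apply/seteqP; split => x /=; rewrite mul1r.
Qed.

Lemma measurable_sign (b : bool) (B : set (borel R)) : measurable B ->
  measurable ((fun x : borel R => (-1) ^+ b * (x : R) : borel R) @^-1` B).
Proof.
move=> mB; rewrite -[X in measurable X]setTI.
by apply: (@measurable_funM _ _ _ setT (fun=> _) (fun x : borel R => x)).
Qed.

(** The preimage of a box is a box with permuted and possibly reflected sides, hence of the same
    volume; [tuple_measure_unique] extends this to all events. *)
Lemma ge0_integral_signed_perm n (s : {perm 'I_n}) (e : 'I_n -> bool)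
    (f : n.-tuple (borel R) -> \bar R) :
  measurable_fun setT f -> (forall t, 0 <= f t)%E ->
  (\int[lebesgue_tuple R n]_t f (signed_perm s e t) =
   \int[lebesgue_tuple R n]_t f t)%E.
Proof.
move=> mf f0.
pose phi_mixin := isMeasurableFun.Build _ _ _ _ _ (measurable_signed_perm s e).
pose phi : {mfun _ >-> _} := HB.pack (signed_perm s e) phi_mixin.
have pushE A : measurable A -> pushforward (lebesgue_tuple R n) phi A =
  lebesgue_tuple R n A.
  apply: (tuple_measure_unique (m := pushforward (lebesgue_tuple R n) phi)) => B mB.
  rewrite /= /pushforward.
  (* Coordinate [i] of the image reads coordinate [s i], so the constraint [B i] falls on [s i],
     whence the inverse of [s]. *)
  transitivity (lebesgue_tuple R n (box (fun j =>
     (fun x : borel R => (-1) ^+ e ((s^-1)%g j) * (x : R) : borel R) @^-1` B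
       ((s^-1)%g j)))).
    congr (lebesgue_tuple R n _); apply/seteqP; split => t /= H i.
      by have := H ((s^-1)%g i); rewrite tnth_mktuple permKV.
    by have := H (s i); rewrite /= permK tnth_mktuple.
  rewrite lebesgue_box; last by move=> i; exact: measurable_sign.
  rewrite (reindex_inj (@perm_inj _ s))/=; apply: eq_bigr => i _.
  by rewrite permK lebesgue_measure_sign.
rewrite -[RHS](@eq_measure_integral _ _ _ setT _ (pushforward
  (lebesgue_tuple R n) phi)); last first.
  by move=> A mA _; exact: pushE.
by rewrite ge0_integral_pushforward.
Qed.

Definition cat_tuples m n (p : m.-tuple (borel R) * n.-tuple (borel R)) :
  (m + n).-tuple (borel R) := [tuple of p.1 ++ p.2].

Lemma measurable_cat_tuples m n : measurable_fun setT (@cat_tuples m n).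
Proof.
apply/measurable_fun_tnthP => i; case: (split_ordP i) => j ->.
  rewrite (_ : _ \o _ = (@tnth _ _)^~ j \o fst).
    by apply: (measurableT_comp (measurable_tnth j)); exact: measurable_fst.
  by apply/funext => p; rewrite /= tnth_lshift.
rewrite (_ : _ \o _ = (@tnth _ _)^~ j \o snd).
  by apply: (measurableT_comp (measurable_tnth j)); exact: measurable_snd.
by apply/funext => p; rewrite /= tnth_rshift.
Qed.

(** By induction on [m], the first point is split off on both sides; for [m = 0] the measure is the
    Dirac mass at the empty tuple. *)
Lemma ge0_integral_cat_tuples m n (f : (m + n).-tuple (borel R) -> \bar R) :
  measurable_fun setT f -> (forall t, 0 <= f t)%E ->
  (\int[lebesgue_tuple R (m + n)]_t f t =
   \int[(lebesgue_tuple R m \x lebesgue_tuple R n)%E]_p f (cat_tuples p))%E.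
Proof.
move=> mf f0; have mfc := measurableT_comp mf (@measurable_cat_tuples m n).
rewrite (fubini_tonelli1 (f \o @cat_tuples m n))//; last by move=> p; exact: f0.
rewrite /fubini_F.
elim: m f mf f0 mfc => [|m IH] f mf f0 mfc.
  rewrite /= integral_dirac ?diracT ?mul1e//; last first.
    exact: (measurable_fun_fubini_tonelli_F (f \o @cat_tuples 0 n)) mfc (fun p => f0 _).
  rewrite ?mul1e; apply: eq_integral => t _ /=; congr f; exact: val_inj.
have mfx x : measurable_fun setT (f \o @cons_pair R (m + n) \o pair x).
  apply: measurableT_comp => //; apply: measurableT_comp => //.
  exact: measurable_cons_pair.
rewrite ge0_integral_lebesgue_cons//.
rewrite [RHS]ge0_integral_lebesgue_cons//; last 2 first.
- exact: (measurable_fun_fubini_tonelli_F (f \o @cat_tuples m.+1 n)) mfc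
    (fun p => f0 _).
- by move=> t; apply: integral_ge0 => y _; exact: f0.
apply: eq_integral => x _.
rewrite (IH (fun t => f (cons_pair (x, t)))) //; [|exact: mfx|].
  by apply: eq_integral => u _; apply: eq_integral => v _ /=; congr f; exact: val_inj.
exact: measurableT_comp (mfx x) (@measurable_cat_tuples m n).
Qed.

End tuple_integral.

(** * Measures with a density and the substitution y = x^2 *)

Section density.
Local Open Scope ereal_scope.
Context d (T : measurableType d) (R : realType).

Import HBNNSimple.

(** The integration formula holds for indicators by construction, then for simple functions by
    linearity, and in general by monotone convergence. *)
Lemma ge0_density_measure (mu : {measure set T -> \bar R}) (f : T -> R) :
  measurable_fun setT f -> (forall x, 0 <= f x)%R ->
  exists2 nu : {measure set T -> \bar R},
    forall A, measurable A -> nu A = \int[mu]_(x in A) (f x)%:E &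
    forall g : T -> \bar R, measurable_fun setT g -> (forall x, 0 <= g x) ->
      \int[nu]_x g x = \int[mu]_x (g x * (f x)%:E).
Proof.
move=> mf f0; pose nu A := \int[mu]_(x in A) (f x)%:E.
have nu0 : nu set0 = 0 by exact: integral_set0.
have nu_ge0 A : 0 <= nu A by apply: integral_ge0 => x _; rewrite lee_fin.
have nu_sigma_additive : semi_sigma_additive nu.
  move=> F mF tF mUF; rewrite /nu ge0_integral_bigcup//; last 2 first.
  - exact/measurable_EFinP/measurable_funTS.
  - by move=> x _; rewrite lee_fin.
  apply: is_cvg_ereal_nneg_natsum => n _.
  by apply: integral_ge0 => x _; rewrite lee_fin.
pose nuM := isMeasure.Build _ _ _ nu nu0 nu_ge0 nu_sigma_additive.
have [m mE] : exists m : {measure set T -> \bar R}, forall A, m A = nu A.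
  by exists (HB.pack nu nuM : {measure set T -> \bar R}).
exists m => [A _|]; first exact: mE.
move=> g mg g0.
pose h := nnsfun_approx measurableT mg.
have gE x : g x = limn (EFin \o h ^~ x).
  by apply/esym/cvg_lim => //; exact: cvg_nnsfun_approx.
have h_nd x : {homo (fun n => (h n x)%:E) : i j / (i <= j)%N >-> i <= j}.
  by move=> i j ij; rewrite lee_fin; exact/lefP/nd_nnsfun_approx.
transitivity (limn (fun n => \int[m]_x (h n x)%:E)).
  rewrite -monotone_convergence//.
  - by apply: eq_integral => x _; exact: gE.
  - by move=> n; exact/measurable_EFinP.
  - by move=> n x _; rewrite lee_fin.
transitivity (limn (fun n => \int[mu]_x ((h n x)%:E * (f x)%:E))); last first.
  rewrite -monotone_convergence//.
  - apply: eq_integral => x _; rewrite gE.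
    apply/cvg_lim => //; rewrite -gE.
    have : (EFin \o h^~ x) @ \oo --> g x by exact: cvg_nnsfun_approx.
    by apply: cvgeZr.
  - by move=> n; apply: emeasurable_funM => //; exact/measurable_EFinP.
  - by move=> n x _; rewrite mule_ge0// lee_fin.
  - by move=> x _ i j ij; rewrite lee_wpmul2r ?lee_fin//; exact/lefP/nd_nnsfun_approx.
congr (limn _); apply/funext => n.
rewrite integralT_nnsfun sintegralE.
under [RHS]eq_integral.
  move=> x _; rewrite fimfunE -fsumEFin// ge0_mule_fsuml; last first.
    by move=> r; exact: nnfun_muleindic_ge0.
  over.
rewrite ge0_integral_fsum//; last 2 first.
- by move=> r; apply: emeasurable_funM; apply/measurable_EFinP => //;
    exact: measurable_funM.
- by move=> r x _; rewrite mule_ge0 ?lee_fin//; exact: nnfun_muleindic_ge0.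
apply: eq_fsbigr => r /set_mem [x _ rx].
have r0 : (0 <= r)%R by rewrite -rx.
under [RHS]eq_integral do rewrite EFinM -muleA.
rewrite ge0_integralZl//; last 2 first.
- by apply: emeasurable_funM; exact/measurable_EFinP.
- by move=> y _; rewrite mule_ge0 ?lee_fin.
congr (_ * _); rewrite mE /nu integral_mkcond; apply: eq_integral => y _.
rewrite patchE indicE; case: ifPn => _; rewrite ?mul1e ?mul0e//.
Qed.
End density.

(** * The change of variables y = x^2, on the line and on tuples *)

Section square_substitution.
Context {R : realType}.
Local Notation mu := (@lebesgue_measure R).

Local Notation pos := (\1_(`]0%R, +oo[%classic : set R) : R -> R).

Lemma posE (x : R) : pos x = (0 < x)%R%:R.
Proof. by rewrite indicE mem_setE in_itv/= andbT. Qed.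

Lemma integral_double (a b : R) : (0 <= a <= b) ->
  (\int[mu]_(x in `]a, b]) (2 * x)%:E = (b ^+ 2 - a ^+ 2)%:E)%E.
Proof.
move=> /andP[a0]; rewrite le_eqVlt => /predU1P[->|ab].
  by rewrite set_itvoc0 integral_set0 subrr.
rewrite integral_itv_obnd_cbnd; last first.
  by apply/measurable_funTS/measurable_EFinP; apply: measurable_funM.
rewrite (@continuous_FTC2 _ _ (fun x : R => x ^+ 2))//.
- by apply: continuous_subspaceT => x; apply: cvgM; [exact: cvg_cst|exact: cvg_id].
- split.
  + by move=> x _; exact: exprn_derivable.
  + apply: cvg_at_right_filter; exact: exprn_continuous.
  + apply: cvg_at_left_filter; exact: exprn_continuous.
- by move=> x _; rewrite derive1E exp_derive /= expr1 /GRing.scale /= mulr1 mulr_natl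
    -mulr_natl.
Qed.

(* Under x |-> x^2 the measure 2 x dx on the half-line becomes Lebesgue measure: both
   give b^+ - a^+ to ]a, b], since Num.sqrt vanishes on negative numbers. *)
Lemma ge0_integral_sqr_pos (g : R -> \bar R) :
  measurable_fun setT g -> (forall y, 0 <= g y)%E ->
  (\int[mu]_x (g (x ^+ 2)%R * (2 * x * pos x)%:E) =
   \int[mu]_y (g y * (pos y)%:E))%E.
Proof.
move=> mg g0.
have mpos : measurable_fun setT pos by exact: measurable_indic.
have pos0 x : 0 <= pos x by rewrite indicE.
have m2pos : measurable_fun setT (fun x : R => 2 * x * pos x).
  by apply: measurable_funM => //; exact: measurable_funM.
have pos20 x : 0 <= 2 * x * pos x.
  rewrite posE; case: ltP => [x0|_]; last by rewrite mulr0.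
  by rewrite mulr1 mulr_ge0// ltW.
have [nu1 nu1E int1] := @ge0_density_measure _ _ R mu _ m2pos pos20.
have [nu2 nu2E int2] := @ge0_density_measure _ _ R mu _ mpos pos0.
have msqr : measurable_fun setT (fun x : borel R => (x : R) ^+ 2 : borel R).
  exact: exprn_measurable.
have mpre A : measurable A -> measurable ((fun x : borel R =>
  (x : R) ^+ 2 : borel R) @^-1` A).
  by move=> mA; rewrite -[X in measurable X]setTI; exact: msqr.
rewrite -int2//.
pose phi_mixin := isMeasurableFun.Build _ _ _ _ _ msqr.
pose phi : {mfun borel R >-> borel R} :=
  HB.pack (fun x : borel R => (x : R) ^+ 2 : borel R) phi_mixin.
have nu1oc (a b : R) : (a <= b)%R -> nu1 (phi @^-1` `]a, b]) =
  (Num.max b 0 - Num.max a 0)%:E.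
  move=> ab; rewrite nu1E; last exact: mpre.
  have sqE (c : R) : Num.sqrt c ^+ 2 = Num.max c 0.
    by case: leP => [/ler0_sqrtr ->|/ltW /sqr_sqrtr]; rewrite ?expr0n.
  rewrite -!sqE -integral_double; last by rewrite sqrtr_ge0 ler_wsqrtr.
  rewrite integral_mkcond [RHS]integral_mkcond; apply: eq_integral => x _.
  rewrite !patchE /= !mem_setE /= !in_itv /= posE.
  case: (ltP 0 x) => [x0|x0]; last first.
    have -> : (Num.sqrt a < x) = false by apply/negbTE;
      rewrite -leNgt (le_trans x0)// sqrtr_ge0.
    by rewrite mulr0 if_same.
  rewrite mulr1; congr (if _ then _ else _); congr (_ && _).
    by rewrite -{2}(gtr0_norm x0) -sqrtr_sqr ltr_sqrt// exprn_gt0.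
  by rewrite -{2}(gtr0_norm x0) -sqrtr_sqr !leNgt ltr_sqrt// exprn_gt0.
have nu2oc (a b : R) : (a <= b)%R -> nu2 `]a, b]%classic =
  (Num.max b 0 - Num.max a 0)%:E.
  move=> ab; rewrite nu2E// integral_indic//.
  rewrite (_ : _ `&` _ = `]Num.max a 0, Num.max b 0]%classic); last first.
    apply/seteqP; split => x /=; rewrite !in_itv/= !andbT.
      by rewrite gt_max le_max => -[-> /andP[-> ->]].
    rewrite gt_max le_max => /andP[/andP[-> x0]] /orP[->//|].
    by rewrite leNgt x0.
  transitivity (lebesgue_measure (`]Num.max a 0, Num.max b 0]%classic : set R)) => //.
  rewrite lebesgue_measure_itv/= lte_fin; case: ltP => // h.
  by apply/esym; congr EFin; apply/eqP;
    rewrite subr_eq0 eq_le h ge_max !le_max ab lexx orbT.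
(* Half-open intervals are stable under intersection and generate the Borel sets, and the intervals
   []-k, k]] exhaust the line with finite mass. *)
have nu12 A : measurable A -> nu1 (phi @^-1` A) = nu2 A.
  have := @measure_unique _ R (borel R) (@ocitv R)
    (fun k => `]- k%:R, k%:R]%classic) _ _ _ _ (pushforward nu1 phi) nu2 _ _ A;
    apply=> //.
  - by move=> X Y; exact: (@measurableI _ (ocitv_type R)).
  - by move=> k; exists (- k%:R, k%:R).
  - apply/seteqP; split => // x _; exists (Num.truncn `|x|).+1 => //=.
    by rewrite in_itv/=; have /ltr_normlP[? /ltW->] := truncnS_gt `|x|;
      rewrite andbT ltrNl.
  - move=> _ [[a b] _ <-] /=; have [ab|ba] := leP a b.
      by exact: etrans (nu1oc _ _ ab) (esym (nu2oc _ _ ab)).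
    by rewrite set_itv_ge ?measure0// -leNgt bnd_simp ltW.
  - move=> k; rewrite [X in (X < _)%E](nu1oc (- k%:R) k%:R) ?ltry//.
    by rewrite (le_trans (_ : _ <= 0))// oppr_le0.
rewrite -[RHS](@eq_measure_integral _ _ _ setT _ (pushforward nu1 phi)); last first.
  by move=> A mA _; exact: nu12.
rewrite ge0_integral_pushforward// int1//; last by move=> y; exact: g0.
exact: (measurableT_comp mg msqr).
Qed.

(* Twice 1 / (2 sqrt y), for the two preimages of y under squaring; the value at 0
   is 0 because 0 `^ p = 0 for p != 0. *)
Definition sqr_jacobian (y : R) : R :=
  if 0 <= y then y `^ (- 2^-1) else 0.

Lemma sqr_jacobian_ge0 y : 0 <= sqr_jacobian y.
Proof. by rewrite /sqr_jacobian; case: ifP => // _; exact: powR_ge0. Qed.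

Lemma measurable_sqr_jacobian : measurable_fun setT sqr_jacobian.
Proof.
apply: measurable_fun_ifT; last exact: measurable_cst.
  exact: measurable_fun_ler.
exact: measurable_powR.
Qed.

(** By evenness the integral is twice the one over the positive half-line; there
    [2 = 2 x (x^2)^(-1/2)], so [ge0_integral_sqr_pos] applies to [g] times the Jacobian. *)
Lemma ge0_integral_sqr (g : R -> \bar R) :
  measurable_fun setT g -> (forall y, 0 <= g y)%E ->
  (\int[mu]_x (g (x ^+ 2)%R) = \int[mu]_y (g y * (sqr_jacobian y)%:E))%E.
Proof.
move=> mg g0.
have mgs : measurable_fun setT (fun x : R => g (x ^+ 2)).
  by apply: measurableT_comp => //; exact: exprn_measurable.
have mj : measurable_fun setT (EFin \o sqr_jacobian).
  by apply/measurable_EFinP; exact: measurable_sqr_jacobian.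
transitivity (2%:E * \int[mu]_(x in `]0%R, +oo[) (g (x ^+ 2)%R))%E.
  rewrite -(setUv `[0, +oo[%classic) ge0_integral_setU//=; last 3 first.
  - exact: measurableC.
  - by rewrite setUv.
  - exact/disj_setPCl.
  rewrite mule_natl mule2n setCitvr integral_itv_bndo_bndc;
    last exact: measurable_funTS.
  rewrite integral_itv_obnd_cbnd; last exact: measurable_funTS.
  congr +%E; rewrite ge0_integration_by_substitution0//.
  by apply: eq_integral => x _; rewrite sqrrN.
(* The Jacobian already vanishes off the open half-line, including at 0, so the indicator can be
   inserted. *)
transitivity (\int[mu]_y (g y * (sqr_jacobian y)%:E * (pos y)%:E))%E; last first.
  apply: eq_integral => y _; rewrite -muleA -EFinM; congr (_ * _%:E)%E.
  rewrite posE /sqr_jacobian; case: ltgtP => [y0|y0|<-]; rewrite ?mulr1 ?mul0r//.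
  by rewrite powR0 ?mul0r// oppr_eq0 invr_eq0.
rewrite -(ge0_integral_sqr_pos (g := fun y => (g y * (sqr_jacobian y)%:E)%E));
  last 2 first.
- exact: emeasurable_funM.
- by move=> y; rewrite mule_ge0// lee_fin sqr_jacobian_ge0.
rewrite -ge0_integralZl//=; last first.
  exact: measurable_funTS.
rewrite integral_mkcond; apply: eq_integral => x _.
rewrite patchE mem_setE in_itv/= andbT posE; case: ltP => x0;
  last by rewrite mulr0 mule0.
rewrite mulr1 -muleA -EFinM muleC; congr (_ * _%:E)%E.
rewrite /sqr_jacobian sqr_ge0 -powR_mulrn ?ltW// -powRrM mulrN divff// powR_inv1 ?ltW//.
by rewrite mulrCA mulVf ?mulr1// gt_eqF.
Qed.

Lemma tnth_sqr_points n (t : n.-tuple R) i : tnth (sqr_points t) i = tnth t i ^+ 2.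
Proof. by rewrite tnth_map. Qed.

Lemma measurable_sqr_points n :
  measurable_fun setT (@sqr_points R n : n.-tuple (borel R) -> n.-tuple (borel R)).
Proof.
apply/measurable_fun_tnthP => i.
rewrite (_ : _ \o _ = (fun x : R => x ^+ 2) \o (@tnth n (borel R))^~ i); last first.
  by apply/funext => t /=; rewrite tnth_sqr_points.
apply: (@measurableT_comp _ _ _ _ _ _ (fun x : borel R => (x : R) ^+ 2 : borel R)).
  exact: exprn_measurable.
exact: measurable_tnth.
Qed.

Lemma measurable_prod_tnth n (h : R -> R) : measurable_fun setT h ->
  measurable_fun setT (fun t : n.-tuple (borel R) => \prod_(i < n) h (tnth t i)).
Proof.
move=> mh; apply: measurable_prod => i _.
exact: (measurableT_comp mh (measurable_tnth i)).
Qed.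

(** By induction, the remaining coordinates are substituted with the first one fixed, and then the
    first one by the one-dimensional formula. *)
Lemma ge0_integral_sqr_points n (f : n.-tuple (borel R) -> \bar R) :
  measurable_fun setT f -> (forall t, 0 <= f t)%E ->
  (\int[lebesgue_tuple R n]_t f (sqr_points t) =
   \int[lebesgue_tuple R n]_t (f t * (\prod_(i < n) sqr_jacobian (tnth t i))%:E))%E.
Proof.
elim: n f => [|n IH] f mf f0.
  by apply: eq_integral => t _; rewrite big_ord0 mule1; congr f;
    rewrite [LHS]tuple0 [RHS]tuple0.
have mcons x : measurable_fun setT (fun t => cons_pair (x, t) : n.+1.-tuple (borel R)).
  exact: (measurableT_comp (@measurable_cons_pair R n) (pair1_measurable x)).
have mprod m : measurable_fun setT (fun t : m.-tuple (borel R) =>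
    (\prod_(i < m) sqr_jacobian (tnth t i))%:E).
  by apply/measurable_EFinP; apply: measurable_prod_tnth;
    exact: measurable_sqr_jacobian.
have prod0 m (t : m.-tuple (borel R)) : (0 <= (\prod_(i < m) sqr_jacobian
  (tnth t i))%:E)%E.
  by rewrite lee_fin prodr_ge0// => i _; exact: sqr_jacobian_ge0.
rewrite ge0_integral_lebesgue_cons//; last first.
  exact: (measurableT_comp mf (@measurable_sqr_points n.+1)).
rewrite ge0_integral_lebesgue_cons//; last 2 first.
- by apply: emeasurable_funM => //; exact: mprod.
- by move=> t; rewrite mule_ge0.
pose g (y : R) := (\int[lebesgue_tuple R n]_t (f (cons_pair (y, t)) *
   (\prod_(i < n) sqr_jacobian (tnth t i))%:E))%E.
have g0 y : (0 <= g y)%E by apply: integral_ge0 => t _; rewrite mule_ge0.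
have mg : measurable_fun setT g.
  apply: (measurable_fun_fubini_tonelli_F (fun p : borel R * n.-tuple (borel R) =>
    f (cons_pair p) * (\prod_(i < n) sqr_jacobian (tnth p.2 i))%:E)%E).
    apply: emeasurable_funM.
      exact: (measurableT_comp mf (@measurable_cons_pair R n)).
    exact: (measurableT_comp (mprod n) measurable_snd).
  by move=> p; rewrite mule_ge0.
transitivity (\int[mu]_x g (x ^+ 2)%R)%E.
  apply: eq_integral => x _; rewrite /g -IH//;
    last exact: (measurableT_comp mf (mcons _)).
  by apply: eq_integral => t _; congr f; exact: val_inj.
rewrite ge0_integral_sqr//; apply: eq_integral => y _.
rewrite /g -ge0_integralZr//=; last 3 first.
- apply: emeasurable_funM; [exact: (measurableT_comp mf (mcons _))|exact: mprod].
- by move=> t _; apply: mule_ge0; [exact: f0|exact: prod0].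
- by rewrite lee_fin sqr_jacobian_ge0.
apply: eq_integral => t _; rewrite -muleA -EFinM big_ord_recl mulrC;
  congr (_ * (_ * _)%:E)%E.
by apply: eq_bigr => i _; rewrite tnthS.
Qed.

End square_substitution.

(** * Joint laws *)

Section joint_law.
Context {R : realType} d (T : measurableType d) (P : probability T R).

(** A negative constant would make the total mass nonpositive instead of 1. Its nonnegativity makes
    [c * f] the density of a measure. *)
Lemma normalized_density n (X : T -> n.-tuple R) (f : n.-tuple R -> R) :
  measurable_fun setT (f : n.-tuple (borel R) -> R) -> (forall t, 0 <= f t) ->
  has_density_propto P X f ->
  exists2 c : R, 0 <= c & forall A : set (n.-tuple (borel R)), measurable A ->
    P (X @^-1` A) = (\int[lebesgue_tuple R n]_(t in A) (c * f t)%:E)%E.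
Proof.
move=> mf f0 [c Pc].
have I0 A : (0 <= \int[lebesgue_tuple R n]_(t in A) (f t)%:E)%E.
  by apply: integral_ge0 => t _; rewrite lee_fin.
have c0 : 0 <= c.
  rewrite leNgt; apply/negP => c0.
  have := Pc setT measurableT; rewrite preimage_setT probability_setT => /eqP.
  by rewrite gt_eqF// (le_lt_trans (mule_le0_ge0 _ (I0 _)))// lee_fin ltW.
exists c => // A mA; rewrite Pc//.
under [RHS]eq_integral do rewrite EFinM.
rewrite ge0_integralZl//.
  by apply/measurable_EFinP/measurable_funTS.
by move=> t _; rewrite lee_fin.
Qed.

Lemma ge0_integral_prod_setX m n (f : m.-tuple (borel R) -> R) (g : n.-tuple
  (borel R) -> R) A B :
  measurable A -> measurable B ->
  measurable_fun setT f -> measurable_fun setT g ->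
  (forall t, 0 <= f t) -> (forall t, 0 <= g t) ->
  (\int[(lebesgue_tuple R m \x lebesgue_tuple R n)%E]_(p in A `*` B)
    (f p.1 * g p.2)%:E =
   (\int[lebesgue_tuple R m]_(t in A) (f t)%:E) * \int[lebesgue_tuple R n]_(t in B)
     (g t)%:E)%E.
Proof.
move=> mA mB mf mg f0 g0.
have mfA : measurable_fun setT (fun t => (\1_A t * f t)%:E).
  by apply/measurable_EFinP; apply: measurable_funM => //; exact: measurable_indic.
have mgB : measurable_fun setT (fun t => (\1_B t * g t)%:E).
  by apply/measurable_EFinP; apply: measurable_funM => //; exact: measurable_indic.
have mkc d' (U : measurableType d') (mu : {measure set U -> \bar R})
     (D : set U) (h : U -> R) :
    (\int[mu]_(x in D) (h x)%:E = \int[mu]_x (\1_D x * h x)%:E)%E.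
  rewrite integral_mkcond; apply: eq_integral => x _; rewrite patchE indicE.
  by case: ifP => _; rewrite ?mul1r ?mul0r.
rewrite (mkc _ _ _ (A `*` B)) (mkc _ _ _ A) (mkc _ _ _ B).
pose F (p : m.-tuple (borel R) * n.-tuple (borel R)) : \bar R :=
  ((\1_A p.1 * f p.1)%:E * (\1_B p.2 * g p.2)%:E)%E.
have F0 p : (0 <= F p)%E by rewrite /F mule_ge0// lee_fin mulr_ge0// indicE.
transitivity (\int[(lebesgue_tuple R m \x lebesgue_tuple R n)%E]_p F p)%E.
  apply: eq_integral => p _; rewrite /F -EFinM mulrACA; congr (_ * _)%:E.
  by rewrite !indicE in_setX; case: (_ \in A); case: (_ \in B); rewrite ?mulr1 ?mulr0.
rewrite (fubini_tonelli1 F)//; last first.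
  by apply: emeasurable_funM; [exact: (measurableT_comp mfA measurable_fst)|
    exact: (measurableT_comp mgB measurable_snd)].
rewrite /fubini_F /F /=.
under eq_integral => x _.
  rewrite ge0_integralZl//=; last 2 first.
  - by move=> y _; rewrite lee_fin mulr_ge0// indicE.
  - by rewrite lee_fin mulr_ge0// indicE.
  over.
rewrite ge0_integralZr//.
- by move=> y _; rewrite lee_fin mulr_ge0// indicE.
- by apply: integral_ge0 => y _; rewrite lee_fin mulr_ge0// indicE.
Qed.

(** The law of the pair, by independence, and the measure with the product density, by Tonelli,
    agree with the product of the marginals on rectangles, hence everywhere. *)
Lemma joint_density m n (X : T -> m.-tuple R) (Y : T -> n.-tuple R) f g :
  measurable_fun setT (X : T -> m.-tuple (borel R)) ->
  measurable_fun setT (Y : T -> n.-tuple (borel R)) ->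
  measurable_fun setT (f : m.-tuple (borel R) -> R) ->
  measurable_fun setT (g : n.-tuple (borel R) -> R) ->
  (forall t, 0 <= f t) -> (forall t, 0 <= g t) ->
  has_density_propto P X f -> has_density_propto P Y g -> independent P X Y ->
  exists c : R, forall C : set (m.-tuple (borel R) * n.-tuple (borel R)),
    measurable C ->
    P ((fun w => (X w, Y w)) @^-1` C) =
    (c%:E * \int[(lebesgue_tuple R m \x lebesgue_tuple R n)%E]_(p in C)
      (f p.1 * g p.2)%:E)%E.
Proof.
move=> mX mY mf mg f0 g0 /(normalized_density mf f0)[a a0 XE].
move=> /(normalized_density mg g0)[b b0 YE] XY.
exists (a * b) => C mC.
pose Xm := isMeasurableFun.Build _ _ _ _ _ mX.
pose X' : {mfun T >-> m.-tuple (borel R)} := HB.pack (X : T -> m.-tuple (borel R)) Xm.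
pose Ym := isMeasurableFun.Build _ _ _ _ _ mY.
pose Y' : {mfun T >-> n.-tuple (borel R)} := HB.pack (Y : T -> n.-tuple (borel R)) Ym.
have mZ : measurable_fun setT (fun w => (X w, Y w) : m.-tuple (borel R) * n.-tuple
  (borel R)).
  exact/measurable_fun_pair.
pose Zm := isMeasurableFun.Build _ _ _ _ _ mZ.
pose Z' : {mfun T >-> (m.-tuple (borel R) * n.-tuple (borel R))%type} :=
  HB.pack (fun w => (X w, Y w) : m.-tuple (borel R) * n.-tuple (borel R)) Zm.
have maf : measurable_fun setT (fun t : m.-tuple (borel R) => a * f t).
  by apply: measurable_funM.
have mbg : measurable_fun setT (fun t : n.-tuple (borel R) => b * g t).
  by apply: measurable_funM.
have mh : measurable_fun setT
    (fun p : m.-tuple (borel R) * n.-tuple (borel R) => (a * f p.1) * (b * g p.2)).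
  by apply: measurable_funM; [exact: (measurableT_comp maf measurable_fst)|
    exact: (measurableT_comp mbg measurable_snd)].
have mh' : measurable_fun setT
    (fun p : m.-tuple (borel R) * n.-tuple (borel R) => f p.1 * g p.2).
  by apply: measurable_funM; [exact: (measurableT_comp mf measurable_fst)|
    exact: (measurableT_comp mg measurable_snd)].
have [|nu nuE _] := ge0_density_measure (lebesgue_tuple R m \x lebesgue_tuple R n)%E mh.
  by move=> p; rewrite !mulr_ge0.
have E1 := @product_measure_unique _ _ _ _ R (distribution P X') (distribution P Y')
  (distribution P Z').
have E2 := @product_measure_unique _ _ _ _ R (distribution P X') (distribution P Y') nu.
transitivity (nu C).
  apply: etrans (E2 _ C mC); first by apply/esym/E1 => // A B mA mB; exact: XY.
  move=> A B mA mB; rewrite nuE; last exact: measurableX.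
  rewrite (@ge0_integral_prod_setX _ _ (fun t => a * f t) (fun t => b * g t))//.
  - by rewrite /distribution /pushforward /= -XE -?YE.
  - by move=> t; rewrite mulr_ge0.
  - by move=> t; rewrite mulr_ge0.
rewrite nuE// -ge0_integralZl//.
- by apply: eq_integral => p _; rewrite -EFinM mulrACA.
- by apply/measurable_EFinP/measurable_funTS.
- by move=> p _; rewrite lee_fin mulr_ge0.
- by rewrite lee_fin mulr_ge0.
Qed.

End joint_law.

(** * Superposition *)

Lemma sum_ord_parity N :
  ((\sum_(i < N) ~~ odd i)%N = uphalf N) * ((\sum_(i < N) odd i)%N = N./2).
Proof.
split; elim: N => [|N IH]; rewrite ?big_ord0// big_ord_recr/= IH.
  by rewrite uphalf_half; case: (odd N) => /=; lia.
by rewrite addnC uphalf_half.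
Qed.

(** Points are numbered from 1 but ordinals from 0, so the parities are exchanged. *)
Lemma in_parity_class1 N (i : 'I_N) : (i \in parity_class N 1) = ~~ odd i.
Proof. by rewrite inE !modn2 /=; case: (odd i). Qed.

Lemma in_parity_class2 N (i : 'I_N) : (i \in parity_class N 2) = odd i.
Proof. by rewrite inE !modn2 /=; case: (odd i). Qed.

Lemma card_parity_class N :
  (#|parity_class N 1| = uphalf N) * (#|parity_class N 2| = N./2).
Proof.
split; rewrite -sum1_card big_mkcond /= -(sum_ord_parity N); apply: eq_bigr => i _.
  by rewrite in_parity_class1; case: odd.
by rewrite in_parity_class2; case: odd.
Qed.

(** The two classes partition the indices. An event on unordered points can thus be read on the pair
    of parity parts, whose joint density is known. *)
Lemma perm_parity_part (R : realType) N (t : N.-tuple R) :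
  perm_eq (parity_part 1 t ++ parity_part 2 t) t.
Proof.
have E k : parity_part k t = [seq tnth t i | i <- enum (parity_class N k)] :> seq R.
  apply: (@eq_from_nth _ 0); rewrite size_tuple ?size_map -?cardE// => i ik.
  have := tnth_mktuple
    (fun j : 'I_#|parity_class N k| => tnth t (enum_val j)) (Ordinal ik).
  rewrite (tnth_nth 0) /= => ->.
  have x0 := enum_val (Ordinal ik).
  by rewrite (nth_map x0) -?cardE// (enum_val_nth x0).
rewrite !E -map_cat -[X in perm_eq _ X](map_tnth_enum t).
apply: perm_map; apply: uniq_perm; rewrite ?enum_uniq//.
  rewrite cat_uniq !enum_uniq andbT /=; apply/hasPn => i.
  by rewrite !mem_enum in_parity_class1 in_parity_class2 negbK.
by move=> i; rewrite mem_cat !mem_enum in_parity_class1 in_parity_class2 orNb.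
Qed.

Section superposition.
Context {R : realType}.

(** Measurability of the weight enters through this composite; the moment hypothesis supplies it. *)
Definition weight_sqr (V : R -> \bar R) (x : R) : R := weight V (x ^+ 2).

Lemma weight_ge0 (V : R -> \bar R) x : 0 <= weight V x.
Proof. by rewrite /weight fine_ge0// expeR_ge0. Qed.

Lemma sqr_vandermonde_ge0 n (t : n.-tuple R) : 0 <= sqr_vandermonde t.
Proof. by apply: prodr_ge0 => i _; apply: prodr_ge0 => j _; rewrite exprn_ge0. Qed.

Lemma measurable_sqr_vandermonde n :
  measurable_fun setT (@sqr_vandermonde R n : n.-tuple (borel R) -> R).
Proof.
apply: measurable_prod => i _; under eq_fun do rewrite big_mkcond.
apply: measurable_prod => j _; case: (i < j)%N => //.
apply: measurable_funX; apply: measurableT_comp => //.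
by apply: measurable_funB; exact: measurable_tnth.
Qed.

(* [root_density] and [power_density] with an arbitrary number of points in place
   of the size of the parity class. *)
Definition gen_root_density V n k (t : n.-tuple R) : R :=
  sqr_vandermonde (sqr_points t) *
  \prod_(i < n) (tnth t i ^+ (2 * (k - 1)) * weight V (tnth t i ^+ 2)).

Lemma gen_root_density_ge0 V n k (t : n.-tuple R) : 0 <= gen_root_density V k t.
Proof.
rewrite mulr_ge0 ?sqr_vandermonde_ge0// prodr_ge0// => i _.
by rewrite mulr_ge0 ?weight_ge0// exprM exprn_ge0// sqr_ge0.
Qed.

Lemma measurable_gen_root_density V n k : measurable_fun setT (weight_sqr V) ->
  measurable_fun setT (@gen_root_density V n k : n.-tuple (borel R) -> R).
Proof.
move=> mw; apply: measurable_funM.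
  exact: (measurableT_comp (@measurable_sqr_vandermonde n)
    (@measurable_sqr_points R n)).
apply: (measurable_prod_tnth
  (h := fun x : R => x ^+ (2 * (k - 1)) * weight V (x ^+ 2))).
by apply: measurable_funM => //; exact: exprn_measurable.
Qed.

Lemma measurable_cat_event m n N (A : set (multiset R)) : (m + n)%N = N ->
  measurable [set t : N.-tuple (borel R) | A (seq_mset t)] ->
  measurable [set p : m.-tuple (borel R) * n.-tuple (borel R) |
    A (seq_mset (cat_tuples p))].
Proof.
move=> <- mA; rewrite -[X in measurable X]setTI.
exact: (@measurable_cat_tuples R m n measurableT _ mA).
Qed.

Lemma measurable_sqr_event N (A : set (multiset R)) :
  measurable [set t : N.-tuple (borel R) | A (seq_mset t)] ->
  measurable [set t : N.-tuple (borel R) | A (seq_mset (sqr_points t))].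
Proof.
move=> mA; rewrite -[X in measurable X]setTI.
exact: (@measurable_sqr_points R N measurableT _ mA).
Qed.

Lemma seq_mset_signed_perm n (s : {perm 'I_n}) e (t : n.-tuple R) :
  seq_mset (sqr_points (signed_perm s e t)) = seq_mset (sqr_points t).
Proof.
apply/eq_seq_msetP; apply/tuple_permP; exists s.
congr (tval _); apply: eq_from_tnth => i.
by rewrite !tnth_mktuple tnth_sqr_points tnth_mktuple exprMn sqrr_sign mul1r
  tnth_sqr_points.
Qed.

(** This is [sum_interlace_det] integrated against the event and the weight. On the left
    [2 ^ (m + n)] counts the sign vectors; on the right it is the constant of that identity, and the
    last factor counts the relabellings. *)
Lemma integral_superposition V m n N (A : set (multiset R)) :
    (n <= m)%N -> (m <= n.+1)%N -> (m + n)%N = N ->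
    measurable_fun setT (weight_sqr V) ->
    measurable [set t : N.-tuple (borel R) | A (seq_mset t)] ->
  ((#|block_perms m n| * 2 ^ (m + n))%:R%:E *
     \int[lebesgue_tuple R N]_(t in [set t | A (seq_mset (sqr_points t))])
       (ensemble_density V t)%:E =
   (2 ^ (m + n) * #|{perm 'I_(m + n)}|)%:R%:E *
     \int[(lebesgue_tuple R m \x lebesgue_tuple R n)%E]_(p in
         [set p | A (seq_mset (sqr_points (cat_tuples p)))])
       (gen_root_density V 1 p.1 * gen_root_density V 2 p.2)%:E)%E.
Proof.
move=> nm mn <- mw mA {N}.
pose SA := [set t : (m + n).-tuple (borel R) | A (seq_mset (sqr_points t))].
have mSA : measurable SA by exact: measurable_sqr_event.
(* [h] gathers the factors invariant under signed permutations: the event and the even weight. *)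
pose h (t : (m + n).-tuple (borel R)) : R :=
  \1_SA t * \prod_(i < m + n) weight_sqr V (tnth t i).
have mh : measurable_fun setT h.
  by apply: measurable_funM; [exact: measurable_indic|exact: measurable_prod_tnth].
have h0 t : 0 <= h t.
  by rewrite mulr_ge0 ?indicE// prodr_ge0// => i _; exact: weight_ge0.
have hs s e t : h (signed_perm s e t) = h t.
  rewrite /h !indicE; congr (_ * _).
    by congr (_%:R); congr nat_of_bool; apply/idP/idP => /set_mem H; apply/mem_set;
      move: H; rewrite /SA /= seq_mset_signed_perm.
  rewrite [RHS](reindex_inj (@perm_inj _ s)); apply: eq_bigr => i _.
  by rewrite /weight_sqr tnth_mktuple exprMn sqrr_sign mul1r.
pose D (t : (m + n).-tuple R) := split_det (tnth t) ^+ 2.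
have DE u v : D (cat_tuples (u, v)) = _ := split_det_sqr u v.
have mD : measurable_fun setT (D : (m + n).-tuple (borel R) -> R).
  rewrite /D /split_det; apply: measurable_funX.
  rewrite /determinant; apply: measurable_sum => s.
  apply: measurable_funM => //; apply: measurable_prod => i _.
  under eq_fun do rewrite mxE.
  case: ((m <= i)%N == _); last exact: measurable_cst.
  by apply: measurable_funX; exact: measurable_tnth.
(* Since [h] and Lebesgue measure are both invariant, every summand has the same integral. *)
have key (q : (m + n).-tuple (borel R) -> R) (I : finType) s e :
    measurable_fun setT q -> (forall t, 0 <= q t) ->
  (\int[lebesgue_tuple R (m + n)]_t
     (h t * \sum_(i : I) q (signed_perm (s i) (e i) t))%:E =
   #|I|%:R%:E * \int[lebesgue_tuple R (m + n)]_t (h t * q t)%:E)%E.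
  move=> mq q0; under eq_integral do rewrite mulr_sumr -sumEFin.
  rewrite ge0_integral_sum//; last 2 first.
  - move=> i; apply/measurable_EFinP; apply: measurable_funM => //.
    exact: (measurableT_comp mq (@measurable_signed_perm R _ (s i) (e i))).
  - by move=> i t _; rewrite lee_fin mulr_ge0.
  rewrite (eq_bigr (fun=> \int[lebesgue_tuple R (m + n)]_t (h t * q t)%:E)%E).
    by rewrite sumr_const mule_natl.
  move=> i _; under eq_integral do rewrite -(hs (s i) (e i)).
  rewrite (@ge0_integral_signed_perm R _ (s i) (e i) (fun t => (h t * q t)%:E))//.
  - by apply/measurable_EFinP; apply: measurable_funM.
  - by move=> t; rewrite lee_fin mulr_ge0.
have sv0 (t : (m + n).-tuple R) := sqr_vandermonde_ge0 t.
have D0 t : 0 <= D t by exact: sqr_ge0.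
have IE : (\int[lebesgue_tuple R (m + n)]_(t in SA) (ensemble_density V t)%:E =
    \int[lebesgue_tuple R (m + n)]_t (h t * sqr_vandermonde t)%:E)%E.
  rewrite integral_mkcond; apply: eq_integral => t _; rewrite patchE /h indicE.
  by case: ifP => _; rewrite ?mul0r// mul1r mulrC.
have JE : (\int[(lebesgue_tuple R m \x lebesgue_tuple R n)%E]_(p in
         [set p | SA (cat_tuples p)])
       (gen_root_density V 1 p.1 * gen_root_density V 2 p.2)%:E =
    \int[lebesgue_tuple R (m + n)]_t (h t * D t)%:E)%E.
  rewrite ge0_integral_cat_tuples//; last 2 first.
  - by apply/measurable_EFinP; apply: measurable_funM.
  - by move=> t; rewrite lee_fin mulr_ge0.
  rewrite integral_mkcond; apply: eq_integral => -[u v] _; rewrite patchE /h indicE.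
  rewrite (_ : ((u, v) \in _) = (cat_tuples (u, v) \in SA)); last first.
    by apply/idP/idP => /set_mem H; exact/mem_set.
  case: ifP => _; rewrite ?mul0r// mul1r DE /gen_root_density big_split_ord/=.
  congr EFin; rewrite !big_split/=.
  have -> : \prod_(i < m) weight_sqr V (tnth (cat_tuples (u, v)) (lshift n i)) =
      \prod_(i < m) weight V (tnth u i ^+ 2).
    by apply: eq_bigr => i _; rewrite /weight_sqr tnth_lshift.
  have -> : \prod_(i < n) weight_sqr V (tnth (cat_tuples (u, v)) (rshift m i)) =
      \prod_(i < n) weight V (tnth v i ^+ 2).
    by apply: eq_bigr => i _; rewrite /weight_sqr tnth_rshift.
  rewrite [\prod_(i < m) _ ^+ (_ * (1 - 1))]big1 ?mul1r//.
  ring.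
rewrite IE JE.
(* The averaging lemma is used twice: with all signs and no relabelling for the full determinant,
   with all relabellings and no sign for the split one. *)
have := @key (@sqr_vandermonde R (m + n))
  {ffun 'I_(m + n) -> bool} (fun=> 1%g) (fun e => e)
    (@measurable_sqr_vandermonde _) sv0.
have := @key D {perm 'I_(m + n)} (fun s => s) (fun=> xpred0) mD D0.
rewrite card_ffun card_bool card_ord.
rewrite !natrM !EFinM -!muleA => <- <-.
have hsum0 (q : (m + n).-tuple (borel R) -> R) (I : finType) s e :
    (forall t, 0 <= q t) ->
    forall t, 0 <= h t * \sum_(i : I) q (signed_perm (s i) (e i) t).
  by move=> q0 t; rewrite mulr_ge0// sumr_ge0.
have mhsum (q : (m + n).-tuple (borel R) -> R) (I : finType) s e :
    measurable_fun setT q ->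
    measurable_fun setT (fun t => (h t * \sum_(i : I) q (signed_perm (s i)
      (e i) t))%:E).
  move=> mq; apply/measurable_EFinP; apply: measurable_funM => //.
  apply: measurable_sum => i.
  exact: (measurableT_comp mq (@measurable_signed_perm R _ (s i) (e i))).
rewrite -!ge0_integralZl//.
- apply: eq_integral => t _; rewrite -!EFinM; congr EFin.
  rewrite mulrCA [RHS]mulrCA; congr (_ * _).
  have := sum_interlace_det (tnth t).
  rewrite natrX => E; apply: etrans (etrans _ E) _.
    congr (_ * _); apply: eq_bigr => e _; rewrite -interlace_det_sqr//;
      congr (interlace_det _ ^+ 2).
    by apply/funext => i; rewrite tnth_mktuple perm1.
  congr (_ * _); apply: eq_bigr => s _; congr (split_det _ ^+ 2).
  by apply/funext => i; rewrite tnth_mktuple expr0 mul1r.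
- exact: (mhsum D _ (fun s => s) (fun=> xpred0)).
- by move=> t _; rewrite lee_fin; apply: (hsum0 D _ (fun s => s) (fun=> xpred0)).
- exact: (mhsum (@sqr_vandermonde R _)
    {ffun _ -> bool} (fun=> 1%g) (fun e => e) (@measurable_sqr_vandermonde _)).
- by move=> t _; rewrite lee_fin;
    apply: (hsum0 (@sqr_vandermonde R _) {ffun _ -> bool} (fun=> 1%g) (fun e => e)).
Qed.

End superposition.

(** * From root densities to power densities *)

Section power_substitution.
Context {R : realType}.
Implicit Types (V : R -> \bar R) (n k : nat).

Definition gen_power_density V n k (t : n.-tuple R) : R :=
  if [forall i, 0 <= tnth t i] then
    sqr_vandermonde t *
    \prod_(i < n) (tnth t i `^ (k%:R - 3 / 2) * weight V (tnth t i))
  else 0.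

(* A root density is a function of the squared points; the absolute value keeps this
   function nonnegative off the positive orthant. *)
Definition folded_density V n k (s : n.-tuple R) : R :=
  sqr_vandermonde s *
  \prod_(i < n) (`|tnth s i| ^+ (k - 1) * weight_sqr V (Num.sqrt (tnth s i))).

Lemma folded_density_ge0 V n k (s : n.-tuple R) : 0 <= folded_density V k s.
Proof.
rewrite mulr_ge0 ?sqr_vandermonde_ge0// prodr_ge0// => i _.
by rewrite mulr_ge0 ?weight_ge0// exprn_ge0.
Qed.

Lemma measurable_folded_density V n k : measurable_fun setT (weight_sqr V) ->
  measurable_fun setT (folded_density V k : n.-tuple (borel R) -> R).
Proof.
move=> mw; apply: measurable_funM; first exact: measurable_sqr_vandermonde.
apply: (measurable_prod_tnth (h :=
  fun x : R => `|x| ^+ (k - 1) * weight_sqr V (Num.sqrt x))).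
apply: measurable_funM; first by apply: measurable_funX; exact: normr_measurable.
apply: (measurableT_comp mw); apply: continuous_measurable_fun; exact: sqrt_continuous.
Qed.

Lemma gen_root_densityE V n k (t : n.-tuple R) :
  gen_root_density V k t = folded_density V k (sqr_points t).
Proof.
rewrite /gen_root_density /folded_density; congr (_ * _); apply: eq_bigr => i _.
rewrite tnth_sqr_points /weight_sqr sqr_sqrtr ?sqr_ge0// ger0_norm ?sqr_ge0//.
by rewrite exprM.
Qed.

(** The exponent splits as [k - 3/2 = (k - 1) - 1/2], the second part being the Jacobian. Off the
    positive orthant some Jacobian factor vanishes. *)
Lemma gen_power_densityE V n k (t : n.-tuple R) : k = 1%N \/ k = 2%N ->
  gen_power_density V k t =
  folded_density V k t * \prod_(i < n) sqr_jacobian (tnth t i).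
Proof.
move=> k12; rewrite /gen_power_density /folded_density; case: ifPn => [/forallP t0|].
  rewrite -[RHS]mulrA; congr (_ * _); rewrite -big_split/=; apply: eq_bigr => i _.
  have ti0 := t0 i.
  rewrite /sqr_jacobian ti0 ger0_norm// /weight_sqr sqr_sqrtr// mulrAC; congr (_ * _).
  case: k12 => ->.
    by rewrite subnn expr0 mul1r; congr (_ `^ _); lra.
  (* Adding exponents requires a nonzero base here; at 0 both sides are 0. *)
  rewrite subn1 expr1; have [->|tn0] := eqVneq (tnth t i) 0.
    by rewrite mul0r powR0//; lra.
  rewrite -{2}(powRr1 ti0) -powRD; last by rewrite tn0 implybT.
  by congr (_ `^ _); lra.
rewrite negb_forall => /existsP[i ti].
by rewrite [X in _ * X](bigD1 i)//= /sqr_jacobian (negbTE ti) mul0r mulr0.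
Qed.

Lemma gen_power_density_ge0 V n k (t : n.-tuple R) : 0 <= gen_power_density V k t.
Proof.
rewrite /gen_power_density; case: ifP => // _.
rewrite mulr_ge0 ?sqr_vandermonde_ge0// prodr_ge0// => i _.
by rewrite mulr_ge0 ?weight_ge0 ?powR_ge0.
Qed.

Lemma measurable_gen_power_density V n k : k = 1%N \/ k = 2%N ->
  measurable_fun setT (weight_sqr V) ->
  measurable_fun setT (gen_power_density V k : n.-tuple (borel R) -> R).
Proof.
move=> k12 mw; rewrite (_ : gen_power_density V k =
  fun t => folded_density V k t * \prod_(i < n) sqr_jacobian (tnth t i)); last first.
  by apply/funext => t; exact: gen_power_densityE.
apply: measurable_funM; first exact: measurable_folded_density.
by apply: measurable_prod_tnth; exact: measurable_sqr_jacobian.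
Qed.

(** Concatenation turns the pair into one tuple of [m + n] points, where [ge0_integral_sqr_points]
    applies, and back. *)
Lemma ge0_integral_sqr_points_pair m n
    (f : m.-tuple (borel R) * n.-tuple (borel R) -> \bar R) :
  measurable_fun setT f -> (forall p, 0 <= f p)%E ->
  (\int[(lebesgue_tuple R m \x lebesgue_tuple R n)%E]_p
     f (sqr_points p.1, sqr_points p.2) =
   \int[(lebesgue_tuple R m \x lebesgue_tuple R n)%E]_p
     (f p * ((\prod_(i < m) sqr_jacobian (tnth p.1 i)) *
             (\prod_(i < n) sqr_jacobian (tnth p.2 i)))%:E))%E.
Proof.
move=> mf f0.
pose l (t : (m + n).-tuple (borel R)) : m.-tuple (borel R) :=
  [tuple tnth t (lshift n i) | i < m].
pose r (t : (m + n).-tuple (borel R)) : n.-tuple (borel R) :=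
  [tuple tnth t (rshift m i) | i < n].
pose g t := f (l t, r t).
have mlr : measurable_fun setT (fun t => (l t, r t)).
  apply/measurable_fun_pair; apply/measurable_fun_tnthP => i.
    rewrite (_ : _ \o _ = (@tnth _ (borel R))^~ (lshift n i));
      first exact: measurable_tnth.
    by apply/funext => t /=; rewrite tnth_mktuple.
  rewrite (_ : _ \o _ = (@tnth _ (borel R))^~ (rshift m i));
    first exact: measurable_tnth.
  by apply/funext => t /=; rewrite tnth_mktuple.
have mg : measurable_fun setT g by exact: (measurableT_comp mf mlr).
have g0 t : (0 <= g t)%E by exact: f0.
have gE p : g (cat_tuples p) = f p.
  case: p => u v; rewrite /g; congr (f (_, _)); apply: eq_from_tnth => i.
    by rewrite tnth_mktuple tnth_lshift.
  by rewrite tnth_mktuple tnth_rshift.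
transitivity (\int[lebesgue_tuple R (m + n)]_t g (sqr_points t))%E.
  rewrite ge0_integral_cat_tuples//;
    last exact: (measurableT_comp mg (@measurable_sqr_points R _)).
  apply: eq_integral => -[u v] _; rewrite -gE; congr g.
  by apply: val_inj; rewrite /= map_cat.
rewrite ge0_integral_sqr_points// ge0_integral_cat_tuples//.
- apply: eq_integral => -[u v] _; rewrite gE big_split_ord/=; congr (_ * (_ * _)%:E)%E.
    by apply: eq_bigr => i _; rewrite tnth_lshift.
  by apply: eq_bigr => i _; rewrite tnth_rshift.
- apply: emeasurable_funM => //; apply/measurable_EFinP.
  by apply: measurable_prod_tnth; exact: measurable_sqr_jacobian.
- move=> t; rewrite mule_ge0// lee_fin prodr_ge0// => i _; exact: sqr_jacobian_ge0.
Qed.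

(** Both integrands come from [folded_density], composed with squaring on the left and multiplied by
    the Jacobian on the right. No constant appears, as [sqr_jacobian] accounts for both square
    roots. *)
Lemma integral_root_power V m n N (A : set (multiset R)) : (m + n)%N = N ->
    measurable_fun setT (weight_sqr V) ->
    measurable [set t : N.-tuple (borel R) | A (seq_mset t)] ->
  (\int[(lebesgue_tuple R m \x lebesgue_tuple R n)%E]_(p in
       [set p | A (seq_mset (sqr_points (cat_tuples p)))])
     (gen_root_density V 1 p.1 * gen_root_density V 2 p.2)%:E =
   \int[(lebesgue_tuple R m \x lebesgue_tuple R n)%E]_(p in
       [set p | A (seq_mset (cat_tuples p))])
     (gen_power_density V 1 p.1 * gen_power_density V 2 p.2)%:E)%E.
Proof.
move=> mnN mw mA.
have mS := measurable_cat_event mnN mA; set S := [set p | _] in mS.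
pose f (p : m.-tuple (borel R) * n.-tuple (borel R)) : \bar R :=
  (\1_S p * (folded_density V 1 p.1 * folded_density V 2 p.2))%:E.
have mf : measurable_fun setT f.
  apply/measurable_EFinP; apply: measurable_funM; first exact: measurable_indic.
  apply: measurable_funM.
    exact: (measurableT_comp (measurable_folded_density 1 mw) measurable_fst).
  exact: (measurableT_comp (measurable_folded_density 2 mw) measurable_snd).
have f0 p : (0 <= f p)%E.
  by rewrite lee_fin mulr_ge0 ?indicE// mulr_ge0// folded_density_ge0.
transitivity (\int[(lebesgue_tuple R m \x lebesgue_tuple R n)%E]_p
     f (sqr_points p.1, sqr_points p.2))%E.
  rewrite integral_mkcond; apply: eq_integral => -[u v] _; rewrite patchE /f indicE.
  rewrite (_ : ((sqr_points u, sqr_points v) \in S) = ((u, v) \in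
     [set p | A (seq_mset (sqr_points (cat_tuples p)))])); last first.
    by apply/idP/idP => /set_mem H; apply/mem_set; move: H; rewrite /S /= map_cat.
  by case: ifP => _; rewrite ?mul0r// mul1r !gen_root_densityE.
rewrite ge0_integral_sqr_points_pair// [RHS]integral_mkcond;
  apply: eq_integral => -[u v] _.
rewrite patchE /f indicE -EFinM.
case: ifP => _; rewrite ?mul0r// mul1r mulrACA.
by rewrite -!gen_power_densityE; [|right|left].
Qed.

End power_substitution.

(** * Comparison of normalizing constants and equality in law *)

Lemma measurable_sqr_cat_event (R : realType) m n N (A : set (multiset R)) :
  (m + n)%N = N ->
  measurable [set t : N.-tuple (borel R) | A (seq_mset t)] ->
  measurable [set p : m.-tuple (borel R) * n.-tuple (borel R) |
    A (seq_mset (sqr_points (cat_tuples p)))].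
Proof.
move=> <- mA; rewrite -[X in measurable X]setTI.
exact: (@measurable_cat_tuples R m n measurableT _ (measurable_sqr_event mA)).
Qed.

(** Two laws whose unnormalized integrals are proportional coincide: [I1] and [J1] are the integrals
    over the whole space, and total mass 1 forces [c1 = c2 a / b]. *)
Lemma eq_normalized (R : realType) (a b c1 c2 : R) (I I1 J J1 p q : \bar R) :
  0 < a -> 0 < b ->
  (a%:E * I = b%:E * J)%E -> (a%:E * I1 = b%:E * J1)%E ->
  (1 = c1%:E * I1)%E -> (1 = c2%:E * J1)%E ->
  (p = c1%:E * I)%E -> (q = c2%:E * J)%E -> p = q.
Proof.
move=> a0 b0 IJ IJ1 c1I c2J -> ->.
(* A real multiple of an infinite value is 0 or infinite, never 1, so both total integrals are
   finite. *)
have fin (c : R) (x : \bar R) : (1 = c%:E * x)%E -> exists2 r, x = r%:E & c * r = 1.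
  case: x => [r /(congr1 fine)/= ->|/esym|/esym]; first by exists r.
    by rewrite mulry; case: sgrP => _;
      rewrite ?mul0e ?mul1e ?mulN1e// => /(congr1 fine)/= /esym/eqP; rewrite oner_eq0.
  by rewrite mulrNy; case: sgrP => _;
    rewrite ?mul0e ?mul1e ?mulN1e// => /(congr1 fine)/= /esym/eqP; rewrite oner_eq0.
have [i1 I1E ci] := fin _ _ c1I; have [j1 J1E cj] := fin _ _ c2J.
have abij : a * i1 = b * j1 by move: IJ1; rewrite I1E J1E => /(congr1 fine).
have an0 : a != 0 by rewrite gt_eqF.
have bn0 : b != 0 by rewrite gt_eqF.
have j1n0 : j1 != 0 by apply/eqP => j0; move/eqP: cj; rewrite j0 mulr0 eq_sym oner_eq0.
have i1n0 : i1 != 0 by apply/eqP => i0; move/eqP: ci; rewrite i0 mulr0 eq_sym oner_eq0.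
have c1E : c1 = c2 / b * a.
  apply: (mulIf i1n0); rewrite ci -[_ * i1]mulrA abij mulrA divfK//.
have -> : c2 = c2 / b * b by rewrite divfK.
by rewrite c1E !EFinM -!muleA IJ.
Qed.

Theorem theorem3p16 (R : realType) (N : nat) (hN : (1 <= N)%N)
    (V : R -> \bar R)
    (V_ninfty : forall x : R, 0 <= x -> V x != -oo%E)
    (V_mass : (0 < \int[@lebesgue_measure R]_x (weight V (x ^+ 2))%:E)%E)
    (V_moments : forall m : nat, (@lebesgue_measure R).-integrable setT
       (fun x => (x ^+ m * weight V (x ^+ 2))%:E))
    (* the points lambda_1, ..., lambda_N of E_R(N) *)
    (d1 : measure_display) (T1 : measurableType d1) (P1 : probability T1 R)
    (lambda : {RV P1 >-> N.-tuple (measurableTypeR R)})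
    (lambda_law : has_density_propto P1 lambda (@ensemble_density R V N))
    (* independent families with laws R_{V,R}(N,1) and R_{V,R}(N,2) *)
    (d2 : measure_display) (T2 : measurableType d2) (P2 : probability T2 R)
    (x : {RV P2 >-> N.-tuple (measurableTypeR R)})
    (x_law : forall k : nat, k = 1%N \/ k = 2%N ->
       has_density_propto P2 (parity_part k \o x) (@root_density R V N k))
    (x_indep : independent P2 (parity_part 1 \o x) (parity_part 2 \o x))
    (* independent families with laws E_R(N,1) and E_R(N,2) *)
    (d3 : measure_display) (T3 : measurableType d3) (P3 : probability T3 R)
    (y : {RV P3 >-> N.-tuple (measurableTypeR R)})
    (y_law : forall k : nat, k = 1%N \/ k = 2%N ->
       has_density_propto P3 (parity_part k \o y) (@power_density R V N k))
    (y_indep : independent P3 (parity_part 1 \o y) (parity_part 2 \o y))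
    (* all these point processes are characterized by their moments *)
    (lambda_det : moment_determinate P1 setT lambda)
    (x_det : forall k : nat, k = 1%N \/ k = 2%N ->
       moment_determinate P2 setT (parity_part k \o x))
    (y_det : forall k : nat, k = 1%N \/ k = 2%N ->
       moment_determinate P3 [set r | 0 <= r] (parity_part k \o y)) :
  eqd_points P1 P2 (@sqr_points R N \o lambda) (@sqr_points R N \o x) /\
  eqd_points P2 P3 (@sqr_points R N \o x) y.
Proof.
have mw : measurable_fun setT (weight_sqr V).
  have /measurable_int/measurable_EFinP := V_moments 0%N.
  by under eq_fun do rewrite expr0 mul1r.
have k1 : 1%N = 1%N \/ 1%N = 2%N by left.
have k2 : 2%N = 1%N \/ 2%N = 2%N by right.
have [c1 c1P] := lambda_law.
have mpart d (T : measurableType d) k (X : T -> N.-tuple (borel R)) :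
    measurable_fun setT X ->
    measurable_fun setT (parity_part k \o X : T -> #|parity_class N k|.-tuple
      (borel R)).
  move=> mX; apply/measurable_fun_tnthP => i.
  rewrite (_ : _ \o _ = (@tnth _ (borel R))^~ (enum_val i) \o X).
    exact: (measurableT_comp (measurable_tnth _) mX).
  by apply/funext => w /=; rewrite tnth_mktuple.
have mx := measurable_funPT x; have my := measurable_funPT y.
(* [root_density] is by conversion [gen_root_density] at the size of the parity class, so the laws
   of the parts fit as they stand. *)
have [c2 c2P] := joint_density (mpart _ _ 1%N _ mx) (mpart _ _ 2%N _ mx)
  (measurable_gen_root_density 1 mw) (measurable_gen_root_density 2 mw)
  (gen_root_density_ge0 V 1) (gen_root_density_ge0 V 2) (x_law _ k1)
    (x_law _ k2) x_indep.
have [c3 c3P] := joint_density (mpart _ _ 1%N _ my) (mpart _ _ 2%N _ my)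
  (measurable_gen_power_density k1 mw) (measurable_gen_power_density k2 mw)
  (gen_power_density_ge0 V 1) (gen_power_density_ge0 V 2) (y_law _ k1)
    (y_law _ k2) y_indep.
have [cardI1 cardI2] := card_parity_class N.
have cardN : (#|parity_class N 1| + #|parity_class N 2|)%N = N.
  by rewrite cardI1 cardI2 uphalf_half -addnA addnn odd_double_half.
have le21 : (#|parity_class N 2| <= #|parity_class N 1|)%N.
  by rewrite cardI1 cardI2 uphalf_half leq_addl.
have le12 : (#|parity_class N 1| <= #|parity_class N 2|.+1)%N.
  by rewrite cardI1 cardI2 uphalf_half -add1n leq_add2r leq_b1.
set m := #|parity_class N 1| in c2P c3P cardN le21 le12 *.
set n := #|parity_class N 2| in c2P c3P cardN le21 le12 *.
have mT (U : measurableType _) (P : Prop) : P -> measurable [set _ : U | P].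
  by move=> HP; rewrite (_ : [set _ | _] = setT)//; apply/seteqP; split.
have xE (A : set (multiset R)) :
    measurable [set t : N.-tuple (borel R) | A (seq_mset t)] ->
    P2 [set w | A (seq_mset (sqr_points (x w)))] =
    (c2%:E * \int[(lebesgue_tuple R m \x lebesgue_tuple R n)%E]_(p in
       [set p | A (seq_mset (sqr_points (cat_tuples p)))])
     (gen_root_density V 1 p.1 * gen_root_density V 2 p.2)%:E)%E.
  move=> mA; rewrite -c2P; last exact: measurable_sqr_cat_event cardN mA.
  congr (P2 _); apply/funext => w /=; congr A; apply/eq_seq_msetP => /=.
  by rewrite perm_sym; apply: perm_map; exact: perm_parity_part.
have yE (A : set (multiset R)) :
    measurable [set t : N.-tuple (borel R) | A (seq_mset t)] ->
    P3 [set w | A (seq_mset (y w))] =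
    (c3%:E * \int[(lebesgue_tuple R m \x lebesgue_tuple R n)%E]_(p in
       [set p | A (seq_mset (cat_tuples p))])
     (gen_power_density V 1 p.1 * gen_power_density V 2 p.2)%:E)%E.
  move=> mA; rewrite -c3P; last exact: measurable_cat_event cardN mA.
  congr (P3 _); apply/funext => w /=; congr A; apply/eq_seq_msetP => /=.
  by rewrite perm_sym; exact: perm_parity_part.
have lE (A : set (multiset R)) :
    measurable [set t : N.-tuple (borel R) | A (seq_mset t)] ->
    P1 [set w | A (seq_mset (sqr_points (lambda w)))] =
    (c1%:E * \int[lebesgue_tuple R N]_(t in [set t | A (seq_mset (sqr_points t))])
       (ensemble_density V t)%:E)%E.
  by move=> mA; rewrite -c1P//; exact: measurable_sqr_event.
(* The sure event supplies the total masses for [eq_normalized]. *)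
have mST : measurable [set t : N.-tuple (borel R) | [set: multiset R]
  (seq_mset t)] by exact: mT.
have P1T : P1 [set w | [set: multiset R] (seq_mset (sqr_points (lambda w)))] = 1%E.
  exact: probability_setT.
have P2T : P2 [set w | [set: multiset R] (seq_mset (sqr_points (x w)))] = 1%E.
  exact: probability_setT.
have P3T : P3 [set w | [set: multiset R] (seq_mset (y w))] = 1%E.
  exact: probability_setT.
split => A mA.
- have := eq_normalized (a := (#|block_perms m n| * 2 ^ (m + n))%:R)
    (b := (2 ^ (m + n) * #|{perm 'I_(m + n)}|)%:R) _ _
    (integral_superposition le21 le12 cardN mw mA)
    (integral_superposition le21 le12 cardN mw mST)
    (etrans (esym P1T) (lE _ mST)) (etrans (esym P2T) (xE _ mST)) (lE _ mA) (xE _ mA).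
  (* Both proportionality constants are positive because the identity is a permutation and preserves
     the blocks. *)
  apply; rewrite ltr0n muln_gt0 expn_gt0//= ?andbT.
    apply/card_gt0P; exists 1%g; rewrite inE; apply/forallP => i; rewrite perm1//.
  by apply/card_gt0P; exists 1%g.
- apply: (@eq_normalized _ 1 1 c2 c3 _ _ _ _ _ _ ltr01 ltr01
    (congr1 (mule 1) (integral_root_power cardN mw mA))
    (congr1 (mule 1) (integral_root_power cardN mw mST))
    (etrans (esym P2T) (xE _ mST)) (etrans (esym P3T) (yE _ mST)) (xE _ mA) (yE _ mA)).
Qed.
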